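(* Let $R$ and $S$ be associative rings and let ${}_SC_R$ be a semidualizing $(S,R)$-bimodule. Consider exact sequences of $S$-modules and $R$-modules, respectively, $$X=\ 0\to W'\to W\to W''\to0,\qquad Y=\ 0\to U'\to U\to U''\to0.$$ (a) If $W',W''\in\mathcal{F}_C(S)$, then $W\in\mathcal{F}_C(S)$. (b) If $W',W''\in\mathcal{P}_C(S)$, then $X$ splits and $W\in\mathcal{P}_C(S)$. (c) If $U',U''\in\mathcal{I}_C(R)$, then $Y$ splits and $U\in\mathcal{I}_C(R)$.
   Context: Rings are associative with unity (not necessarily commutative or noetherian). Modules are unital left modules; right $R$-modules are identified with left $R^{\mathrm{op}}$-modules. An $(S,R)$-bimodule $C={}_SC_R$ is semidualizing if: (a1) ${}_SC$ admits a degreewise finite $S$-projective resolution (a projective resolution by finitely generated projectives); (a2) $C_R$ admits a degreewise finite $R^{\mathrm{op}}$-projective resolution; (b1) the homothety map $S\to\operatorname{Hom}_{R^{\mathrm{op}}}(C,C)$, $s\mapsto(x\mapsto sx)$, is an isomorphism; (b2) the homothety map $R\to\operatorname{Hom}_S(C,C)$, $r\mapsto(x\mapsto xr)$, is an isomorphism; (c1) $\operatorname{Ext}_S^{i}(C,C)=0$ for all $i\geq1$; (c2) $\operatorname{Ext}_{R^{\mathrm{op}}}^{i}(C,C)=0$ for all $i\geq 1$. $\mathcal{F}_C(S)=\{C\otimes_RF\mid {}_RF\text{ flat}\}$, $\mathcal{P}_C(S)=\{C\otimes_RP\mid {}_RP\text{ projective}\}$, $\mathcal{I}_C(R)=\{\operatorname{Hom}_S(C,I)\mid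 {}_SI\text{ injective}\}$ (closed under isomorphism). *)

(* Defs.v *)
From HB Require Import structures.
From mathcomp Require Import all_boot all_algebra.
From mathcomp Require Import boolp.
Set Implicit Arguments.
Unset Strict Implicit.
Unset Printing Implicit Defensive.
Import GRing.Theory.
Local Open Scope ring_scope.
Local Open Scope quotient_scope.

(* Rings are [pzRingType]s: associative and unital, not necessarily           *)
(* commutative, with the zero ring allowed.  Left R-modules are [lmodType R], *)
(* right R-modules are [lmodType R^c]; with the latter convention the product *)
(* a r of a in A : lmodType R^c by r in R is [(r : R^c) *: a].                *)

HB.mixin Record Lmodule_isBimodule (S R : pzRingType) C of GRing.Lmodule S C := {
  ract : C -> R -> C;
  ractA : forall x r r', ract x (r * r') = ract (ract x r) r';
  ract1 : forall x, ract x 1 = x;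
  ractDl : forall x y r, ract (x + y) r = ract x r + ract y r;
  ractDr : forall x r r', ract x (r + r') = ract x r + ract x r';
  ractZ : forall (s : S) x r, ract (s *: x) r = s *: ract x r
}.

#[short(type="bimodType")]
HB.structure Definition Bimodule (S R : pzRingType) :=
  {C of GRing.Lmodule S C & Lmodule_isBimodule S R C}.

(* C_R: the carrier of C, seen as a left module over R^c. *)
Definition rmod (S R : pzRingType) (C : bimodType S R) : Type := C.

Section RightModule.
Variables (S R : pzRingType) (C : bimodType S R).

HB.instance Definition _ := GRing.Zmodule.on (rmod C).

Definition rmod_scale (r : R^c) (x : rmod C) : rmod C := ract (x : C) (r : R).

Fact rmod_scaleA r r' x :
  rmod_scale r (rmod_scale r' x) = rmod_scale (r * r') x.
Proof. by rewrite /rmod_scale -ractA. Qed.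

Fact rmod_scale1 : left_id 1 rmod_scale.
Proof. by move=> x; rewrite /rmod_scale ract1. Qed.

Fact rmod_scaleDr : right_distributive rmod_scale +%R.
Proof. by move=> r x y; rewrite /rmod_scale -ractDl. Qed.

Fact rmod_scaleDl x : {morph rmod_scale^~ x : r r' / r + r'}.
Proof. by move=> r r'; rewrite /rmod_scale -ractDr. Qed.

HB.instance Definition _ := GRing.Zmodule_isLmodule.Build R^c (rmod C)
  rmod_scaleA rmod_scale1 rmod_scaleDr rmod_scaleDl.

End RightModule.

Lemma linear_ext (R : pzRingType) (U V : lmodType R) (f g : {linear U -> V}) :
  f =1 g -> f = g.
Proof.
case: f g => [f [[mf] [sf]]] [g [[mg] [sg]]] /= fg.
have {}fg : f = g by apply: funext.
subst g; have -> : mf = mg by apply: Prop_irrelevance.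
by have -> : sf = sg by apply: Prop_irrelevance.
Qed.

Section Exact.
Variables (R : pzRingType) (M' M M'' : lmodType R).

Definition surjective (X Y : Type) (f : X -> Y) : Prop :=
  forall y, exists x, f x = y.

Definition exact_at (f : {linear M' -> M}) (g : {linear M -> M''}) : Prop :=
  forall x, g x = 0 <-> exists y, f y = x.

Definition short_exact (f : {linear M' -> M}) (g : {linear M -> M''}) : Prop :=
  [/\ injective f, exact_at f g & surjective g].

(* The maps s and r identify M with the direct sum of M' and M''. *)
Definition splits (f : {linear M' -> M}) (g : {linear M -> M''}) : Prop :=
  exists (r : {linear M -> M'}) (s : {linear M'' -> M}),
    [/\ cancel f r, cancel s g & forall x, f (r x) + s (g x) = x].

End Exact.

Definition isomorphic (R : pzRingType) (M N : lmodType R) : Prop :=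
  exists f : {linear M -> N}, bijective f.

Section Tensor.
Variables (R : pzRingType) (A : lmodType R^c) (F : lmodType R).

(* A word [:: (a_1, y_1); ...; (a_n, y_n)] stands for the sum of the          *)
(* a_i (x) y_i.  No formal opposites are needed: - (a (x) y) = (- a) (x) y.   *)
Inductive tensor_rel : seq (A * F) -> seq (A * F) -> Prop :=
| TensorRefl s : tensor_rel s s
| TensorSym s t : tensor_rel s t -> tensor_rel t s
| TensorTrans s t u : tensor_rel s t -> tensor_rel t u -> tensor_rel s u
| TensorCat s s' t t' :
    tensor_rel s s' -> tensor_rel t t' -> tensor_rel (s ++ t) (s' ++ t')
| TensorComm s t : tensor_rel (s ++ t) (t ++ s)
| TensorZero x : tensor_rel [:: (0, x)] [::]
| TensorDl a b x : tensor_rel [:: (a + b, x)] [:: (a, x); (b, x)]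
| TensorDr a x y : tensor_rel [:: (a, x + y)] [:: (a, x); (a, y)]
| TensorMid a (r : R) x :
    tensor_rel [:: ((r : R^c) *: a, x)] [:: (a, r *: x)].

Definition tensor_relb (s t : seq (A * F)) : bool := `[< tensor_rel s t >].

Fact tensor_relb_refl : reflexive tensor_relb.
Proof. by move=> s; apply/asboolP/TensorRefl. Qed.

Fact tensor_relb_sym : symmetric tensor_relb.
Proof. by move=> s t; apply/asboolP/asboolP; apply: TensorSym. Qed.

Fact tensor_relb_trans : transitive tensor_relb.
Proof. by move=> t s u /asboolP st /asboolP tu; apply/asboolP/(TensorTrans st). Qed.

Canonical tensor_equiv :=
  EquivRel tensor_relb tensor_relb_refl tensor_relb_sym tensor_relb_trans.

Definition tensor : Type := {eq_quot tensor_equiv}.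

HB.instance Definition _ := Choice.on tensor.
HB.instance Definition _ := Quotient.on tensor.

Definition tensor_of (s : seq (A * F)) : tensor := \pi s.

Definition pure_tensor (a : A) (x : F) : tensor := tensor_of [:: (a, x)].

Lemma tensor_eqP s t : tensor_of s = tensor_of t <-> tensor_rel s t.
Proof.
split; last by move=> st; apply/eqmodP/asboolP.
by move=> /eqmodP /asboolP.
Qed.

Lemma tensor_reprK x : tensor_of (repr x) = x.
Proof. exact: reprK. Qed.

Lemma repr_tensor_of s : tensor_rel (repr (tensor_of s)) s.
Proof. by apply/tensor_eqP; rewrite tensor_reprK. Qed.

Definition tensor_zero : tensor := tensor_of [::].
Definition tensor_add (x y : tensor) : tensor := tensor_of (repr x ++ repr y).
Definition tensor_opp (x : tensor) : tensor :=
  tensor_of [seq (- p.1, p.2) | p <- repr x].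

Lemma tensor_add_of s t :
  tensor_add (tensor_of s) (tensor_of t) = tensor_of (s ++ t).
Proof. by apply/tensor_eqP/TensorCat; apply: repr_tensor_of. Qed.

Fact tensor_addA : associative tensor_add.
Proof.
move=> x y z; rewrite -[x]tensor_reprK -[y]tensor_reprK -[z]tensor_reprK.
by rewrite !tensor_add_of catA.
Qed.

Fact tensor_addC : commutative tensor_add.
Proof.
move=> x y; rewrite -[x]tensor_reprK -[y]tensor_reprK !tensor_add_of.
exact/tensor_eqP/TensorComm.
Qed.

Fact tensor_add0 : left_id tensor_zero tensor_add.
Proof. by move=> x; rewrite -[x]tensor_reprK tensor_add_of. Qed.

Fact tensor_addN : left_inverse tensor_zero tensor_opp tensor_add.
Proof.
move=> x; rewrite -{2}[x]tensor_reprK /tensor_opp tensor_add_of.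
apply/tensor_eqP; elim: (repr x) => [|[a y] s IHs] /=; first exact: TensorRefl.
set s' := map _ s.
apply: (@TensorTrans _ ([:: (- a, y)] ++ ([:: (a, y)] ++ s ++ s'))).
  by apply: (TensorCat (TensorRefl [:: _])); apply: (TensorComm s' (_ :: _)).
apply: (@TensorTrans _ ([:: (- a, y); (a, y)] ++ (s' ++ s))).
  exact: (TensorCat (TensorRefl [:: _; _]) (TensorComm s s')).
apply: (@TensorTrans _ ([::] ++ [::])); last exact: TensorRefl.
apply: TensorCat => //; apply: TensorTrans (TensorZero y).
by apply: TensorSym; rewrite -(addNr a); apply: TensorDl.
Qed.

HB.instance Definition _ := GRing.isZmodule.Build tensor
  tensor_addA tensor_addC tensor_add0 tensor_addN.

Lemma tensor_ofD s t : tensor_of (s ++ t) = tensor_of s + tensor_of t.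
Proof. by rewrite -[_ + _]/(tensor_add _ _) tensor_add_of. Qed.

Lemma tensor_ofE s : tensor_of s = \sum_(p <- s) pure_tensor p.1 p.2.
Proof.
elim: s => [|[a x] s IHs]; first by rewrite big_nil.
by rewrite big_cons -IHs -cat1s tensor_ofD.
Qed.

Definition balanced (Z : zmodType) (b : A -> F -> Z) : Prop :=
  [/\ forall a a' x, b (a + a') x = b a x + b a' x,
      forall a x x', b a (x + x') = b a x + b a x' &
      forall a (r : R) x, b ((r : R^c) *: a) x = b a (r *: x)].

Lemma pure_tensor_balanced : balanced pure_tensor.
Proof.
split=> *.
- by rewrite /pure_tensor -tensor_ofD; apply/tensor_eqP/TensorDl.
- by rewrite /pure_tensor -tensor_ofD; apply/tensor_eqP/TensorDr.
- exact/tensor_eqP/TensorMid.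
Qed.

Definition tensor_lift (Z : zmodType) (b : A -> F -> Z) (t : tensor) : Z :=
  \sum_(p <- repr t) b p.1 p.2.

Lemma tensor_lift_of (Z : zmodType) (b : A -> F -> Z) s : balanced b ->
  tensor_lift b (tensor_of s) = \sum_(p <- s) b p.1 p.2.
Proof.
case=> bDl bDr bM; have b0 x : b 0 x = 0.
  by apply: (addrI (b 0 x)); rewrite -bDl !addr0.
rewrite /tensor_lift; have := repr_tensor_of s; move: (repr _) => s'.
elim=> {s s'} //=.
- by move=> s t u _ -> _ ->.
- by move=> s s' t t' _ es _ et; rewrite !big_cat /= es et.
- by move=> s t; rewrite !big_cat /= addrC.
- by move=> x; rewrite big_seq1 big_nil b0.
- by move=> a a' x; rewrite !big_cons !big_nil !addr0 bDl.
- by move=> a x x'; rewrite !big_cons !big_nil !addr0 bDr.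
- by move=> a r x; rewrite !big_seq1 bM.
Qed.

Lemma tensor_lift_pure (Z : zmodType) (b : A -> F -> Z) a x : balanced b ->
  tensor_lift b (pure_tensor a x) = b a x.
Proof. by move=> bb; rewrite tensor_lift_of // big_seq1. Qed.

Lemma tensor_liftD (Z : zmodType) (b : A -> F -> Z) : balanced b ->
  {morph tensor_lift b : t u / t + u}.
Proof.
move=> bb t u; rewrite -[t]tensor_reprK -[u]tensor_reprK -tensor_ofD.
by rewrite !tensor_lift_of // big_cat.
Qed.

Lemma tensor_ind_pure (P : tensor -> Prop) : P 0 ->
  (forall a x t, P t -> P (pure_tensor a x + t)) -> forall t, P t.
Proof.
move=> P0 PD t; rewrite -[t]tensor_reprK tensor_ofE.
by elim: (repr t) => [|p s IHs]; rewrite ?big_nil // big_cons; apply: PD.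
Qed.

End Tensor.

(* i (x)_R F *)
Definition tensor_map (R : pzRingType) (A B : lmodType R^c) (F : lmodType R)
    (i : {linear A -> B}) : tensor A F -> tensor B F :=
  tensor_lift (fun a x => pure_tensor (i a) x).

Arguments tensor_map {R A B} F i _.

(* C (x)_R F with the S-action s (c (x) y) = (s c) (x) y. *)
Definition btensor (S R : pzRingType) (C : bimodType S R) (F : lmodType R) :
  Type := tensor (rmod C) F.

Section BimoduleTensor.
Variables (S R : pzRingType) (C : bimodType S R) (F : lmodType R).

HB.instance Definition _ := GRing.Zmodule.on (btensor C F).

Definition bpure (c : C) (x : F) : btensor C F := pure_tensor (c : rmod C) x.

Definition btensor_scale (s : S) : btensor C F -> btensor C F :=
  tensor_lift (fun (c : rmod C) x => bpure (s *: (c : C)) x).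

Lemma btensor_scale_balanced s :
  balanced (fun (c : rmod C) (x : F) => bpure (s *: (c : C)) x).
Proof.
have [pDl pDr pM] := pure_tensor_balanced (rmod C) F.
split=> [c c' x|c x x'|c r x]; rewrite /bpure.
- by rewrite -pDl; congr pure_tensor; apply: (scalerDr s (c : C) (c' : C)).
- by rewrite -pDr.
- by rewrite -pM; congr pure_tensor; apply/esym/ractZ.
Qed.

Lemma btensor_scale_pure s c x : btensor_scale s (bpure c x) = bpure (s *: c) x.
Proof. exact: (tensor_lift_pure _ _ (btensor_scale_balanced s)). Qed.

Fact btensor_scaleDr : right_distributive btensor_scale +%R.
Proof. by move=> s; apply: tensor_liftD (btensor_scale_balanced s). Qed.

Fact btensor_scale0 s : btensor_scale s 0 = 0.
Proof.
by apply: (addrI (btensor_scale s 0)); rewrite -btensor_scaleDr !addr0.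
Qed.

Fact btensor_scaleA s s' t :
  btensor_scale s (btensor_scale s' t) = btensor_scale (s * s') t.
Proof.
elim/tensor_ind_pure: t => [|c x t IHt]; first by rewrite !btensor_scale0.
by rewrite !btensor_scaleDr IHt !btensor_scale_pure scalerA.
Qed.

Fact btensor_scale1 : left_id 1 btensor_scale.
Proof.
elim/tensor_ind_pure=> [|c x t IHt]; first by rewrite btensor_scale0.
by rewrite btensor_scaleDr IHt btensor_scale_pure scale1r.
Qed.

Fact btensor_scaleDl t : {morph btensor_scale^~ t : s s' / s + s'}.
Proof.
move=> s s'; elim/tensor_ind_pure: t => [|c x t IHt].
  by rewrite !btensor_scale0 addr0.
rewrite !btensor_scaleDr IHt !btensor_scale_pure scalerDl addrACA.
have [pDl _ _] := pure_tensor_balanced (rmod C) F.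
by congr (_ + _); apply: pDl.
Qed.

HB.instance Definition _ := GRing.Zmodule_isLmodule.Build S (btensor C F)
  btensor_scaleA btensor_scale1 btensor_scaleDr btensor_scaleDl.

End BimoduleTensor.

Definition rhomothety_fun (S R : pzRingType) (C : bimodType S R) (r : R) :
  C -> C := fun c => ract c r.

Fact rhomothety_is_linear (S R : pzRingType) (C : bimodType S R) (r : R) :
  linear (@rhomothety_fun S R C r).
Proof. by move=> s x y; rewrite /rhomothety_fun ractDl ractZ. Qed.

HB.instance Definition _ (S R : pzRingType) (C : bimodType S R) (r : R) :=
  GRing.isLinear.Build S C C *:%R (@rhomothety_fun S R C r)
    (@rhomothety_is_linear S R C r).

Definition rhomothety (S R : pzRingType) (C : bimodType S R) (r : R) :
  {linear C -> C} := @rhomothety_fun S R C r.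

Definition lhomothety_fun (S R : pzRingType) (C : bimodType S R) (s : S) :
  rmod C -> rmod C := fun c => s *: (c : C).

Fact lhomothety_is_linear (S R : pzRingType) (C : bimodType S R) (s : S) :
  linear (@lhomothety_fun S R C s).
Proof.
move=> r x y; rewrite /lhomothety_fun.
rewrite [LHS](scalerDr s (ract (x : C) r) (y : C)).
by rewrite -[s *: ract _ _]ractZ.
Qed.

HB.instance Definition _ (S R : pzRingType) (C : bimodType S R) (s : S) :=
  GRing.isLinear.Build R^c (rmod C) (rmod C) *:%R (@lhomothety_fun S R C s)
    (@lhomothety_is_linear S R C s).

Definition lhomothety (S R : pzRingType) (C : bimodType S R) (s : S) :
  {linear rmod C -> rmod C} := @lhomothety_fun S R C s.

(* Hom_S(C, I) with the left R-action (r h)(c) = h(c r). *)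
Definition bhom (S R : pzRingType) (C : bimodType S R) (I : lmodType S) : Type :=
  {linear C -> I}.

Section BimoduleHom.
Variables (S R : pzRingType) (C : bimodType S R) (I : lmodType S).
Implicit Types f g h : {linear C -> I}.

HB.instance Definition _ := gen_eqMixin (bhom C I).
HB.instance Definition _ := gen_choiceMixin (bhom C I).

Definition bhom_zero : bhom C I := (\0 : C -> I) : {linear C -> I}.
Definition bhom_add (f g : bhom C I) : bhom C I :=
  ((f : {linear C -> I}) \+ (g : {linear C -> I})) : {linear C -> I}.
Definition bhom_opp (f : bhom C I) : bhom C I :=
  (\- (f : {linear C -> I})) : {linear C -> I}.
Definition bhom_scale (r : R) (f : bhom C I) : bhom C I :=
  ((f : {linear C -> I}) \o rhomothety C r) : {linear C -> I}.

Fact bhom_addA : associative bhom_add.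
Proof. by move=> f g h; apply: linear_ext => x /=; rewrite addrA. Qed.

Fact bhom_addC : commutative bhom_add.
Proof. by move=> f g; apply: linear_ext => x /=; rewrite addrC. Qed.

Fact bhom_add0 : left_id bhom_zero bhom_add.
Proof. by move=> f; apply: linear_ext => x /=; rewrite add0r. Qed.

Fact bhom_addN : left_inverse bhom_zero bhom_opp bhom_add.
Proof. by move=> f; apply: linear_ext => x /=; rewrite addNr. Qed.

HB.instance Definition _ := GRing.isZmodule.Build (bhom C I)
  bhom_addA bhom_addC bhom_add0 bhom_addN.

Fact bhom_scaleA r r' f :
  bhom_scale r (bhom_scale r' f) = bhom_scale (r * r') f.
Proof.
by apply: linear_ext => x; rewrite /= /rhomothety_fun /= -ractA.
Qed.

Fact bhom_scale1 : left_id 1 bhom_scale.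
Proof. by move=> f; apply: linear_ext => x; rewrite /= /rhomothety_fun ract1. Qed.

Fact bhom_scaleDr : right_distributive bhom_scale +%R.
Proof. by move=> r f g; apply: linear_ext. Qed.

Fact bhom_scaleDl f : {morph bhom_scale^~ f : r r' / r + r'}.
Proof.
move=> r r'; apply: linear_ext => x /=.
by rewrite /rhomothety_fun ractDr linearD.
Qed.

HB.instance Definition _ := GRing.Zmodule_isLmodule.Build R (bhom C I)
  bhom_scaleA bhom_scale1 bhom_scaleDr bhom_scaleDl.

End BimoduleHom.

Section ModuleClasses.
Variable R : pzRingType.

Definition projective (P : lmodType R) : Prop :=
  forall (M N : lmodType R) (p : {linear M -> N}) (f : {linear P -> N}),
    surjective p -> exists g : {linear P -> M}, forall x, p (g x) = f x.

Definition injective_module (I : lmodType R) : Prop :=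
  forall (M N : lmodType R) (i : {linear M -> N}) (f : {linear M -> I}),
    injective i -> exists g : {linear N -> I}, forall x, g (i x) = f x.

Definition flat (F : lmodType R) : Prop :=
  forall (A B : lmodType R^c) (i : {linear A -> B}),
    injective i -> injective (tensor_map F i).

Definition finitely_generated (M : lmodType R) : Prop :=
  exists (n : nat) (e : 'I_n -> M),
    forall x, exists a : 'I_n -> R, x = \sum_(k < n) a k *: e k.

End ModuleClasses.

(* ... -> P_1 -> P_0 -> M -> 0, with res_diff n : P_(n+1) -> P_n. *)
Record resolution (R : pzRingType) (M : lmodType R) := Resolution {
  res_obj :> nat -> lmodType R;
  res_diff : forall n, {linear res_obj n.+1 -> res_obj n};
  res_aug : {linear res_obj 0%N -> M};
  res_projective : forall n, projective (res_obj n);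
  res_aug_surj : surjective res_aug;
  res_aug_exact : exact_at (res_diff 0%N) res_aug;
  res_exact : forall n, exact_at (res_diff n.+1) (res_diff n)
}.

Definition degreewise_finite_resolution (R : pzRingType) (M : lmodType R) : Prop :=
  exists P : resolution M, forall n, finitely_generated (P n).

Section Ext.
Variables (R : pzRingType) (M N : lmodType R).

Definition cocycle (P : resolution M) i (f : {linear P i -> N}) : Prop :=
  forall x, f (res_diff P i x) = 0.

Definition coboundary (P : resolution M) i : {linear P i -> N} -> Prop :=
  match i return {linear P i -> N} -> Prop with
  | 0%N => fun f => forall x, f x = 0
  | j.+1 => fun f =>
      exists g : {linear P j -> N}, forall x, f x = g (res_diff P j x)
  end.

(* Ext^i(M, N) = 0.  As Ext^i(M, N) is the i-th cohomology of Hom(P, N) for   *)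
(* any projective resolution P of M, no particular P is singled out.          *)
Definition Ext_vanishes (i : nat) : Prop :=
  forall (P : resolution M) (f : {linear P i -> N}),
    cocycle f -> coboundary f.

End Ext.

Record semidualizing (S R : pzRingType) (C : bimodType S R) : Prop :=
  Semidualizing {
    sd_a1 : degreewise_finite_resolution (C : lmodType S);
    sd_a2 : degreewise_finite_resolution (rmod C : lmodType R^c);
    sd_b1 : bijective (@lhomothety S R C);
    sd_b2 : bijective (@rhomothety S R C);
    sd_c1 : forall i, (1 <= i)%N ->
      Ext_vanishes (C : lmodType S) (C : lmodType S) i;
    sd_c2 : forall i, (1 <= i)%N ->
      Ext_vanishes (rmod C : lmodType R^c) (rmod C : lmodType R^c) i
  }.

Section Classes.
Variables (S R : pzRingType) (C : bimodType S R).

Definition FC (W : lmodType S) : Prop :=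
  exists F : lmodType R, flat F /\ isomorphic (btensor C F : lmodType S) W.

Definition PC (W : lmodType S) : Prop :=
  exists P : lmodType R, projective P /\ isomorphic (btensor C P : lmodType S) W.

Definition IC (U : lmodType R) : Prop :=
  exists I : lmodType S,
    injective_module I /\ isomorphic (bhom C I : lmodType R) U.

End Classes.

(* Main.v *)
Require Import Defs.
From HB Require Import structures.
From mathcomp Require Import all_boot all_algebra.
From mathcomp Require Import boolp functions.
Set Implicit Arguments.
Unset Strict Implicit.
Unset Printing Implicit Defensive.
Import GRing.Theory.
Local Open Scope ring_scope.

(* Let P -> C be a finite projective resolution over S.  As                   *)
(* Hom_S(P_n, C) (x) F = Hom_S(P_n, C (x) F), tensoring the exact sequence    *)
(* 0 -> R = Hom_S(C, C) -> Hom_S(P_0, C) -> Hom_S(P_1, C) -> Hom_S(P_2, C)    *)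
(* with a flat F gives F = Hom_S(C, C (x) F) and Ext^1_S(C, C (x) F) = 0.     *)
(* Hence Hom_S(C, -) keeps X exact, Hom_S(C, W) is an extension of flat       *)
(* (projective) modules, and the evaluation C (x) Hom_S(C, W) -> W is         *)
(* bijective by the five lemma; this is (a) and (b), the splitting in (b)     *)
(* coming from a section of Hom_S(C, W) -> Hom_S(C, W'').                     *)
(* For (c), let Q -> C be a finite projective resolution over R^c.  As        *)
(* Q_n (x) Hom_S(C, I) = Hom_S(Hom(Q_n, C), I), one gets                      *)
(* Tor_1(C, Hom_S(C, I)) = 0 for I injective, so C (x) U' -> C (x) U is       *)
(* injective; the map C (x) U' -> I' adjoint to U' = Hom_S(C, I') therefore   *)
(* extends to C (x) U, and its adjoint retracts U onto U'.                    *)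

(** The functors C (x)_R - and Hom_S(C, -) are adjoint, with unit [unit_map] and counit
    [evaluation]; the proof locates modules at which these are bijective. The homological hypotheses
    enter through the natural maps [hom_tensor] and [tensor_bhom], which dual bases invert at
    finitely generated projectives. For (a) and (b), conditions (b2) and (c1) make Hom_S(P, C) exact
    at its start, and tensoring with a flat F preserves this. Hence the unit at F is bijective
    ([unit_map_injective], [unit_map_surjective]), and maps from C to W'' lift to W when the kernel
    of W -> W'' is C (x) F ([bhom_lift]). So F is recovered as Hom_S(C, C (x) F), X stays exact
    under Hom_S(C, -) ([FC_bhom_exact]), and flatness, projectivity and bijectivity of the counit
    pass from the ends to the middle ([flat_extension], [projective_extension],
    [FC_extension_evaluation]). For (c), condition (c2) and injectivity of I make Q (x) Hom_S(C, I)
    exact in degree 1 ([tensor_bhom_exact]), whence C (x) U' -> C (x) U is injective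
    ([btensor_map_injective]). Extending a map into I' along it and returning through the adjunction
    gives a retraction ([IC_splits]), and U is then Hom_S(C, I' x I''). *)

Definition linear_of (R : pzRingType) (U V : lmodType R) (f : U -> V)
    (f_lin : linear f) : {linear U -> V} :=
  HB.pack f (GRing.isLinear.Build R U V *:%R f f_lin).

(** * Linear maps, submodules and splittings *)

Section LinearMaps.
Variable R : pzRingType.
Implicit Types A B I J M N P Q : lmodType R.

(** Maps whose values depend on choices are given by their graph: uniqueness of the value makes any
    choice function linear. *)
Lemma linear_of_graph M N (G : M -> N -> Prop) :
  (forall x, exists y, G x y) ->
  (forall x y y', G x y -> G x y' -> y = y') ->
  (forall (a : R) x y x' y',
    G x y -> G x' y' -> G (a *: x + x') (a *: y + y')) ->
  exists f : {linear M -> N}, forall x, G x (f x).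
Proof.
move=> G_total G_functional G_linear; have [f Gf] := choice G_total.
have f_lin : linear f.
  by move=> a x y; apply: G_functional (Gf _) _; apply: G_linear.
by exists (linear_of f_lin).
Qed.

Lemma injective_ker0 M N (f : {linear M -> N}) x :
  injective f -> f x = 0 -> x = 0.
Proof. by move=> f_inj fx0; apply: f_inj; rewrite fx0 linear0. Qed.

Lemma factor_through_injection A B M (i : {linear A -> B})
    (f : {linear M -> B}) :
  injective i -> (forall x, exists a, i a = f x) ->
  exists g : {linear M -> A}, forall x, i (g x) = f x.
Proof.
move=> i_inj f_im; apply: (linear_of_graph (G := fun x a => i a = f x)) => //.
- by move=> x a a' <- /i_inj.
- by move=> a x y x' y' e e'; rewrite !linearP e e'.
Qed.

Lemma factor_through_surjection A M N (p : {linear M -> N})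
    (f : {linear M -> A}) :
  surjective p -> (forall x, p x = 0 -> f x = 0) ->
  exists g : {linear N -> A}, forall x, g (p x) = f x.
Proof.
move=> p_surj f_ker.
have p_eq x x' : p x = p x' -> f x = f x'.
  move=> e; apply/eqP; rewrite -subr_eq0 -linearB; apply/eqP/f_ker.
  by rewrite linearB e subrr.
have [|||g gP] := @linear_of_graph N A (fun y z => exists2 x, p x = y & f x = z).
- by move=> y; have [x e] := p_surj y; exists (f x), x.
- by move=> y z z' [x <- <-] [x' /esym/p_eq -> <-].
- move=> a y z y' z' [x <- <-] [x' <- <-].
  by exists (a *: x + x'); rewrite linearP.
by exists g => x; have [x' /p_eq -> ->] := gP (p x).
Qed.

Lemma linear_inverse M N (f : {linear M -> N}) :
  injective f -> surjective f ->
  exists g : {linear N -> M}, cancel f g /\ cancel g f.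
Proof.
move=> f_inj f_surj.
have [g fK] := factor_through_injection (f := idfun) f_inj f_surj.
by exists g; split=> // x; apply: f_inj; rewrite fK.
Qed.

Lemma bijective_surjective (T T' : Type) (f : T -> T') :
  bijective f -> surjective f.
Proof. by case=> g _ gK y; exists (g y). Qed.

Lemma isomorphicP M N (f : {linear M -> N}) :
  injective f -> surjective f -> isomorphic M N.
Proof.
by move=> fi fs; have [g [fK gK]] := linear_inverse fi fs; exists f, g.
Qed.

Lemma exact_comp A B M (f : {linear A -> B}) (g : {linear B -> M}) x :
  exact_at f g -> g (f x) = 0.
Proof. by move=> fg; apply: (fg _).2; exists x. Qed.

Record submodule (V : lmodType R) := Submodule {
  sub_set :> V -> Prop;
  sub_set0 : sub_set 0;
  sub_setP : forall (a : R) x y, sub_set x -> sub_set y -> sub_set (a *: x + y)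
}.

Section Submodule.
Variables (V : lmodType R) (N : submodule V).

Definition sub_mem : {pred V} := fun x => `[< N x >].

Fact sub_mem_closed : submod_closed sub_mem.
Proof.
split; first exact/asboolP/sub_set0.
by move=> a x y /asboolP Nx /asboolP Ny; apply/asboolP/sub_setP.
Qed.

HB.instance Definition _ := GRing.isSubmodClosed.Build R V sub_mem sub_mem_closed.

Definition sub_type : Type := {x : V | x \in sub_mem}.

HB.instance Definition _ := SubChoice.copy sub_type {x : V | x \in sub_mem}.
HB.instance Definition _ := [SubChoice_isSubLmodule of sub_type by <:].

(** Submodules leave this section only as injective linear maps, so that kernels and images fit
    directly into exact sequences. *)
Lemma submodule_inclusion :
  exists (K : lmodType R) (k : {linear K -> V}),
    injective k /\ forall x, N x <-> exists y, k y = x.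
Proof.
exists sub_type, (\val : sub_type -> V); split; first exact: val_inj.
move=> x; split=> [Nx|[y <-]]; last exact/asboolP/(valP y).
have xN : x \in sub_mem by apply/asboolP.
by exists (Sub x xN); apply: (SubK (sub_type)).
Qed.

End Submodule.

Lemma kernel_inclusion M N (f : {linear M -> N}) :
  exists (K : lmodType R) (k : {linear K -> M}), injective k /\ exact_at k f.
Proof.
have f0 : f 0 = 0 by apply: linear0.
have fP (a : R) x y : f x = 0 -> f y = 0 -> f (a *: x + y) = 0.
  by move=> fx fy; rewrite linearP fx fy scaler0 addr0.
exact: submodule_inclusion (Submodule f0 fP).
Qed.

Lemma image_factorization M N (f : {linear M -> N}) :
  exists (I : lmodType R) (p : {linear M -> I}) (i : {linear I -> N}),
    [/\ surjective p, injective i & forall x, i (p x) = f x].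
Proof.
have f0 : exists x, f x = 0 by exists 0; apply: linear0.
have fP (a : R) y y' :
    (exists x, f x = y) -> (exists x, f x = y') ->
    exists x, f x = a *: y + y'.
  by move=> [x <-] [x' <-]; exists (a *: x + x'); rewrite linearP.
have [I [i [i_inj iP]]] := submodule_inclusion (Submodule f0 fP).
have [|p pP] := factor_through_injection (f := f) i_inj.
  by move=> x; apply/iP; exists x.
exists I, p, i; split=> // y; have [|x fx] := (iP (i y)).2; first by exists y.
by exists x; apply: i_inj; rewrite pP.
Qed.

(** Since g vanishes on the kernel of f, it descends to the image of f, and injectivity extends it
    from there to N. *)
Lemma injective_module_extend I M N (f : {linear M -> N}) (g : {linear M -> I}) :
  injective_module I -> (forall x, f x = 0 -> g x = 0) ->
  exists g' : {linear N -> I}, forall x, g' (f x) = g x.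
Proof.
move=> I_inj g_ker; have [J [p [i [p_surj i_inj ip]]]] := image_factorization f.
have [|g1 g1P] := factor_through_surjection (f := g) p_surj.
  by move=> x px; apply: g_ker; rewrite -ip px linear0.
have [g' g'P] := I_inj _ _ i g1 i_inj.
by exists g' => x; rewrite -ip g'P g1P.
Qed.

Lemma section_splits (M' M M'' : lmodType R)
    (f : {linear M' -> M}) (g : {linear M -> M''})
    (s : {linear M'' -> M}) :
  short_exact f g -> cancel s g -> splits f g.
Proof.
move=> [f_inj fg _] sK.
have [|r rP] :=
    factor_through_injection (f := (idfun \- (s \o g)) : {linear M -> M}) f_inj.
  by move=> x; apply: (fg _).1; rewrite /= linearB /= sK subrr.
have rE x : f (r x) + s (g x) = x by rewrite rP /= subrK.
exists r, s; split=> // x; apply: f_inj.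
by rewrite rP /= (exact_comp _ fg) linear0 subr0.
Qed.

Lemma retraction_splits (M' M M'' : lmodType R)
    (f : {linear M' -> M}) (g : {linear M -> M''})
    (r : {linear M -> M'}) :
  short_exact f g -> cancel f r -> splits f g.
Proof.
move=> [f_inj fg g_surj] rK.
have [|s sP] := factor_through_surjection
    (f := (idfun \- (f \o r)) : {linear M -> M}) g_surj.
  by move=> x /(fg _).1 [y <-] /=; rewrite rK subrr.
exists r, s; split=> // [y|x]; last by rewrite sP /= addrC subrK.
have [x <-] := g_surj y; rewrite sP /= linearB.
by rewrite (exact_comp _ fg) subr0.
Qed.

Lemma isomorphic_projective P Q : isomorphic P Q -> projective P -> projective Q.
Proof.
move=> [e [e' eK e'K]] P_proj M N p f p_surj.
have e_inj : injective e := can_inj eK.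
have e_surj : surjective e by move=> y; exists (e' y).
have [e1 [_ e1K]] := linear_inverse e_inj e_surj.
have [g gP] := P_proj _ _ p (f \o e) p_surj.
by exists (g \o e1) => x /=; rewrite gP /= e1K.
Qed.

(** The sequence splits because P'' is projective; a map is then lifted on each of the two
    summands. *)
Lemma projective_extension (P' P P'' : lmodType R) (f : {linear P' -> P})
    (g : {linear P -> P''}) :
  short_exact f g -> projective P' -> projective P'' -> projective P.
Proof.
move=> ex P'_proj P''_proj; have [_ _ g_surj] := ex.
have [s sK] := P''_proj _ _ g idfun g_surj.
have [r [s' [_ _ rs']]] := section_splits ex sK.
move=> M N p u p_surj; have [a aP] := P'_proj _ _ p (u \o f) p_surj.
have [b bP] := P''_proj _ _ p (u \o s') p_surj.
exists ((a \o r) \+ (b \o g)) => x.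
by rewrite /= linearD aP bP /= -linearD rs'.
Qed.

Lemma injective_module_prod I J :
  injective_module I -> injective_module J -> injective_module (I * J)%type.
Proof.
move=> I_inj J_inj M N i f i_inj.
have [a aP] := I_inj _ _ i ((fst : {linear (I * J)%type -> I}) \o f) i_inj.
have [b bP] := J_inj _ _ i ((snd : {linear (I * J)%type -> J}) \o f) i_inj.
have ab_lin : linear (fun x => (a x, b x)).
  by move=> c x y; rewrite !linearP.
by exists (linear_of ab_lin) => x /=; rewrite aP bP /= -surjective_pairing.
Qed.

End LinearMaps.

(** * Functoriality and right exactness of the tensor product *)

Section Tensor.
Variable R : pzRingType.
Implicit Types A B D : lmodType R^c.
Implicit Types F G : lmodType R.

Lemma pure_tensorDl A F (a b : A) (x : F) :
  pure_tensor (a + b) x = pure_tensor a x + pure_tensor b x.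
Proof. by case: (pure_tensor_balanced A F). Qed.

Lemma pure_tensorDr A F (a : A) (x y : F) :
  pure_tensor a (x + y) = pure_tensor a x + pure_tensor a y.
Proof. by case: (pure_tensor_balanced A F). Qed.

Lemma pure_tensorM A F (a : A) (r : R) (x : F) :
  pure_tensor ((r : R^c) *: a) x = pure_tensor a (r *: x).
Proof. by case: (pure_tensor_balanced A F). Qed.

Lemma pure_tensor0l A F (x : F) : pure_tensor (0 : A) x = 0.
Proof. by apply: (addrI (pure_tensor 0 x)); rewrite -pure_tensorDl !addr0. Qed.

Lemma pure_tensor0r A F (a : A) : pure_tensor a (0 : F) = 0.
Proof. by apply: (addrI (pure_tensor a 0)); rewrite -pure_tensorDr !addr0. Qed.

Lemma pure_tensorBl A F (a b : A) (x : F) :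
  pure_tensor (a - b) x = pure_tensor a x - pure_tensor b x.
Proof. by apply/eqP; rewrite eq_sym subr_eq -pure_tensorDl subrK. Qed.

Lemma pure_tensorBr A F (a : A) (x y : F) :
  pure_tensor a (x - y) = pure_tensor a x - pure_tensor a y.
Proof. by apply/eqP; rewrite eq_sym subr_eq -pure_tensorDr subrK. Qed.

Lemma pure_tensor_suml A F (I : Type) (s : seq I) (a : I -> A) (x : F) :
  pure_tensor (\sum_(i <- s) a i) x = \sum_(i <- s) pure_tensor (a i) x.
Proof.
by elim/big_rec2: _ => [|i _ t _ <-]; rewrite ?pure_tensor0l ?pure_tensorDl.
Qed.

Lemma pure_tensor_sumr A F (I : Type) (s : seq I) (a : A) (x : I -> F) :
  pure_tensor a (\sum_(i <- s) x i) = \sum_(i <- s) pure_tensor a (x i).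
Proof.
by elim/big_rec2: _ => [|i _ t _ <-]; rewrite ?pure_tensor0r ?pure_tensorDr.
Qed.

Fact tensor_lift_nmod_morphism A F (Z : zmodType) (b : A -> F -> Z) :
  balanced b -> nmod_morphism (tensor_lift b).
Proof.
move=> bb; split; last exact: tensor_liftD.
by apply: (addrI (tensor_lift b 0)); rewrite -tensor_liftD // !addr0.
Qed.

(** The function is [tensor_lift b]; carrying the proof [bb] as an argument lets additivity be
    inferred as a structure. *)
Definition tensor_hom A F (Z : zmodType) (b : A -> F -> Z) (bb : balanced b) :
  tensor A F -> Z := tensor_lift b.

HB.instance Definition _ A F (Z : zmodType) (b : A -> F -> Z) (bb : balanced b) :=
  GRing.isNmodMorphism.Build (tensor A F) Z (tensor_hom bb)
    (tensor_lift_nmod_morphism bb).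

Lemma tensor_hom_pure A F (Z : zmodType) (b : A -> F -> Z) (bb : balanced b) a x :
  tensor_hom bb (pure_tensor a x) = b a x.
Proof. exact: tensor_lift_pure. Qed.

Lemma tensor_sum A F (t : tensor A F) :
  t = \sum_(p <- repr t) pure_tensor p.1 p.2.
Proof. by rewrite -tensor_ofE tensor_reprK. Qed.

Lemma eq_tensor_hom A F (Z : zmodType) (f g : {additive tensor A F -> Z}) :
  (forall a x, f (pure_tensor a x) = g (pure_tensor a x)) -> f =1 g.
Proof.
by move=> fg t; rewrite [t]tensor_sum !raddf_sum; apply: eq_bigr => p _.
Qed.

Fact tmap_balanced A B F G (p : {linear A -> B}) (q : {linear F -> G}) :
  balanced (fun a x => pure_tensor (p a) (q x)).
Proof.
split=> *; first by rewrite linearD pure_tensorDl.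
  by rewrite linearD pure_tensorDr.
by rewrite !linearZ /= pure_tensorM.
Qed.

Definition tmap A B F G (p : {linear A -> B}) (q : {linear F -> G}) :
  tensor A F -> tensor B G := tensor_hom (tmap_balanced p q).

HB.instance Definition _ A B F G (p : {linear A -> B}) (q : {linear F -> G}) :=
  GRing.Additive.on (tmap p q).

Lemma tmap_pure A B F G (p : {linear A -> B}) (q : {linear F -> G}) a x :
  tmap p q (pure_tensor a x) = pure_tensor (p a) (q x).
Proof. exact: tensor_hom_pure. Qed.

Lemma tmap_tmap A A1 A2 F F1 F2 (p : {linear A -> A1}) (p1 : {linear A1 -> A2})
    (p2 : {linear A -> A2}) (q : {linear F -> F1}) (q1 : {linear F1 -> F2})
    (q2 : {linear F -> F2}) :
  (forall a, p1 (p a) = p2 a) -> (forall x, q1 (q x) = q2 x) ->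
  forall t, tmap p1 q1 (tmap p q t) = tmap p2 q2 t.
Proof.
move=> pE qE; apply: (@eq_tensor_hom _ _ _ (tmap p1 q1 \o tmap p q)) => a x /=.
by rewrite !tmap_pure pE qE.
Qed.

Lemma tmap_comm A A1 A2 A3 F F1 F2 F3
    (p : {linear A -> A1}) (p1 : {linear A1 -> A3})
    (p' : {linear A -> A2}) (p1' : {linear A2 -> A3})
    (q : {linear F -> F1}) (q1 : {linear F1 -> F3})
    (q' : {linear F -> F2}) (q1' : {linear F2 -> F3}) :
  (forall a, p1 (p a) = p1' (p' a)) -> (forall x, q1 (q x) = q1' (q' x)) ->
  forall t, tmap p1 q1 (tmap p q t) = tmap p1' q1' (tmap p' q' t).
Proof.
move=> pE qE t.
by rewrite !(@tmap_tmap _ _ _ _ _ _ _ _ (p1' \o p') _ _ (q1' \o q')).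
Qed.

Lemma tmap_id A F (p : {linear A -> A}) (q : {linear F -> F}) :
  p =1 id -> q =1 id -> forall t, tmap p q t = t.
Proof.
move=> pE qE; apply: (@eq_tensor_hom _ _ _ (tmap p q) idfun) => a x.
by rewrite /= tmap_pure pE qE.
Qed.

Lemma tmap_eq0 A B F G (p : {linear A -> B}) (q : {linear F -> G}) :
  (forall a x, p a = 0 \/ q x = 0) -> forall t, tmap p q t = 0.
Proof.
move=> pq0; apply: (@eq_tensor_hom _ _ _ (tmap p q) \0) => a x;
  rewrite /= tmap_pure.
by case: (pq0 a x) => ->; rewrite ?pure_tensor0l ?pure_tensor0r.
Qed.

Lemma tmap_surjective A B F G (p : {linear A -> B}) (q : {linear F -> G}) :
  surjective p -> surjective q -> surjective (tmap p q).
Proof.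
move=> p_surj q_surj; elim/tensor_ind_pure=> [|b y _ [t <-]].
  by exists 0; rewrite raddf0.
have [[a <-] [x <-]] := (p_surj b, q_surj y).
by exists (pure_tensor a x + t); rewrite raddfD /= tmap_pure.
Qed.

(* Right exactness of the tensor product in both arguments at once: the       *)
(* kernel of p (x) q is generated by the a (x) x with p a = 0 or q x = 0.     *)
(* Choosing set-theoretic sections of p and q sends each defining relation of *)
(* the target to an element of that subgroup N.                               *)
Lemma tmap_kernel A B F G (p : {linear A -> B}) (q : {linear F -> G})
    (N : tensor A F -> Prop) :
  surjective p -> surjective q -> N 0 ->
  (forall t u, N t -> N u -> N (t - u)) ->
  (forall a x, p a = 0 \/ q x = 0 -> N (pure_tensor a x)) ->
  forall t, tmap p q t = 0 -> N t.
Proof.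
move=> p_surj q_surj N0 NB Npq.
have [[sp spK] [sq sqK]] := (choice p_surj, choice q_surj).
have NN t : N t -> N (- t) by rewrite -[- t]add0r; apply: NB.
have ND t u : N t -> N u -> N (t + u).
  by move=> Nt /NN Nu; rewrite -[u]opprK; apply: NB.
have Npure a a' x x' : p a = p a' -> q x = q x' ->
    N (pure_tensor a x - pure_tensor a' x').
  move=> pa qx.
  have -> : pure_tensor a x - pure_tensor a' x' =
      pure_tensor (a - a') x + pure_tensor a' (x - x').
    by rewrite pure_tensorBl pure_tensorBr addrA subrK.
  by apply: ND; apply: Npq; [left|right]; rewrite linearB ?pa ?qx subrr.
(* [l] lifts words through the sections [sp] and [sq]. It is not additive in the entries, but it
   respects the defining relations modulo N. *)
pose l s := tensor_of [seq (sp z.1, sq z.2) | z <- s].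
have lD s t : l (s ++ t) = l s + l t by rewrite /l map_cat tensor_ofD.
have l1 b y : l [:: (b, y)] = pure_tensor (sp b) (sq y) by [].
have l2 b y b' y' :
    l [:: (b, y); (b', y')] = pure_tensor (sp b) (sq y) + pure_tensor (sp b') (sq y').
  by rewrite -cat1s lD !l1.
have Nl s t : tensor_rel s t -> N (l s - l t).
  elim=> {s t}.
  - by move=> s; rewrite subrr.
  - by move=> s t _ Nst; rewrite -opprB; apply: NN.
  - by move=> s t u _ Nst _ Ntu; rewrite -(subrK (l t) (l s)) -addrA; apply: ND.
  - move=> s s' t t' _ Ns _ Nt; rewrite !lD opprD addrACA; exact: ND.
  - by move=> s t; rewrite !lD [l t + _]addrC subrr.
  - move=> y; rewrite l1 subr0; apply: Npq; left; exact: spK.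
  - move=> b b' y; rewrite l1 l2 -pure_tensorDl; apply: Npure => //.
    by rewrite linearD !spK.
  - move=> b y y'; rewrite l1 l2 -pure_tensorDr; apply: Npure => //.
    by rewrite linearD !sqK.
  - move=> b r y; rewrite !l1.
    rewrite -(subrK (pure_tensor ((r : R^c) *: sp b) (sq y)) (pure_tensor _ _)).
    rewrite -addrA; apply: ND; first by apply: Npure;
      rewrite // linearZ /= !spK.
    by rewrite pure_tensorM; apply: Npure; rewrite // linearZ /= !sqK.
move=> t pqt0; have := tensor_reprK t; move: (repr t) => s sE.
have {pqt0} rel0 : tensor_rel [seq (p z.1, q z.2) | z <- s] [::].
  apply/tensor_eqP; transitivity (tmap p q t); last by rewrite pqt0.
  by rewrite -sE !tensor_ofE raddf_sum big_map; apply: eq_bigr => z _;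
    rewrite /= tmap_pure.
have := Nl _ _ rel0; rewrite (_ : l [::] = 0) // subr0 => Ns.
(* The lift of the image of t lies in N by [Ns]; t differs from it term by term by elements covered
   by [Npure]. *)
rewrite -sE -(subrK (l [seq (p z.1, q z.2) | z <- s]) (tensor_of s)).
apply: (ND) => //; rewrite /l -map_comp {sE rel0 Ns}.
elim: s => [|[a x] s IHs] /=; first by rewrite subrr.
rewrite -[_ :: s]cat1s -[_ :: map _ _]cat1s !tensor_ofD opprD addrACA.
by apply: ND => //; apply: (Npure a _ x); rewrite ?spK ?sqK.
Qed.

Lemma tmap_exact_r A F' F F'' (f : {linear F' -> F}) (g : {linear F -> F''}) :
  exact_at f g -> surjective g ->
  forall t, tmap (idfun : {linear A -> A}) g t = 0 ->
  exists u, tmap (idfun : {linear A -> A}) f u = t.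
Proof.
move=> fg g_surj; apply: tmap_kernel => //.
- by move=> a; exists a.
- by exists 0; rewrite raddf0.
- by move=> _ _ [u <-] [v <-]; exists (u - v); rewrite raddfB.
move=> a x [/= ->|/(fg _).1 [y <-]].
  by exists 0; rewrite raddf0 pure_tensor0l.
by exists (pure_tensor a y); rewrite tmap_pure.
Qed.

Lemma tmap_exact_l A' A A'' F (f : {linear A' -> A}) (g : {linear A -> A''}) :
  exact_at f g -> surjective g ->
  forall t, tmap g (idfun : {linear F -> F}) t = 0 ->
  exists u, tmap f (idfun : {linear F -> F}) u = t.
Proof.
move=> fg g_surj; apply: tmap_kernel => //.
- by move=> x; exists x.
- by exists 0; rewrite raddf0.
- by move=> _ _ [u <-] [v <-]; exists (u - v); rewrite raddfB.
move=> a x [/(fg _).1 [b <-]|/= ->].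
  by exists (pure_tensor b x); rewrite tmap_pure.
by exists 0; rewrite raddf0 pure_tensor0r.
Qed.

End Tensor.

(** * Dual bases and free covers *)

Section LocallyProjective.
Variable K : pzRingType.
Implicit Types M N P : lmodType K.

Definition dual_system M := seq (M * {linear M -> K^o}).

Definition dual_expand M (d : dual_system M) (x : M) : M :=
  \sum_(p <- d) (p.2 x : K) *: p.1.

(* Locally projective in the sense of Zimmermann-Huisgen: finite subsets have *)
(* dual bases. *)
Definition locally_projective M : Prop :=
  forall s : seq M, exists d : dual_system M,
    {in s, forall x, dual_expand d x = x}.

Definition dual_basis M (d : dual_system M) : Prop :=
  forall x, dual_expand d x = x.

Lemma locally_projective_dual_basis M (d : dual_system M) :
  dual_basis d -> locally_projective M.
Proof. by move=> dP s; exists d => x _. Qed.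

Lemma locally_projective_retract M N (i : {linear M -> N}) (p : {linear N -> M}) :
  cancel i p -> locally_projective N -> locally_projective M.
Proof.
move=> iK N_lp s; have [d dP] := N_lp [seq i x | x <- s].
exists [seq (p q.1, q.2 \o i : {linear M -> K^o})
       | q : N * {linear N -> K^o} <- d] => x sx.
rewrite /dual_expand big_map -[RHS]iK -[in RHS](dP (i x)) ?map_f //.
by rewrite /dual_expand linear_sum; apply: eq_bigr => q _; rewrite linearZ.
Qed.

Section FreeModule.
Variable M : lmodType K.

Definition finitely_supported (f : M -> K^o) : Prop :=
  exists s : seq M, forall x, x \notin s -> f x = 0.

Fact finitely_supported0 : finitely_supported 0.
Proof. by exists [::]. Qed.

Fact finitely_supportedP (a : K) f g :
  finitely_supported f -> finitely_supported g ->
  finitely_supported (a *: f + g).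
Proof.
move=> [s sP] [s' sP']; exists (s ++ s') => x; rewrite mem_cat negb_or.
by move=> /andP [/sP fx /sP' gx]; rewrite /= !fctE fx gx scaler0 addr0.
Qed.

Definition fin_supp_sum (s : seq M) (f : M -> K^o) : M :=
  \sum_(x <- s) (f x : K) *: x.

(** Both sums reduce to the entries where f is nonzero. This makes the map from the free module to M
    independent of the chosen support. *)
Lemma fin_supp_sum_uniq (f : M -> K^o) s s' :
  uniq s -> uniq s' -> (forall x, x \notin s -> f x = 0) ->
  (forall x, x \notin s' -> f x = 0) -> fin_supp_sum s f = fin_supp_sum s' f.
Proof.
move=> s_uniq s'_uniq sP s'P.
have E (r : seq M) :
    fin_supp_sum r f = \sum_(x <- [seq x <- r | f x != 0]) (f x : K) *: x.
  rewrite /fin_supp_sum big_filter [RHS]big_mkcond; apply: eq_bigr => x _.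
  by case: eqP => //= ->; rewrite scale0r.
rewrite !E; apply/perm_big/uniq_perm; rewrite ?filter_uniq // => x.
rewrite !mem_filter; case: eqP => //= fx.
have [xs|/sP //] := boolP (x \in s).
by have [//|/s'P //] := boolP (x \in s').
Qed.

(** L is the free module on the set M, realized as the finitely supported functions M -> K, and p
    sends the basis element at m to m. *)
Lemma free_cover :
  exists (L : lmodType K) (p : {linear L -> M}),
    surjective p /\ locally_projective L.
Proof.
have [L [k [k_inj kP]]] :=
  submodule_inclusion (Submodule finitely_supported0 finitely_supportedP).
have k_supp l : finitely_supported (k l) by apply/kP; exists l.
have coord_lin x : linear (fun l => k l x : K^o).
  by move=> a l l'; rewrite linearP.
have delta_supp x : finitely_supported (fun y => (y == x)%:R).
  by exists [:: x] => y; rewrite inE => /negPf ->.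
have [e eP] := choice (fun x => (kP _).1 (delta_supp x)).
have supp_uniq l : exists s, uniq s /\ forall x, x \notin s -> k l x = 0.
  have [s sP] := k_supp l; exists (undup s); split=> [|x].
    exact: undup_uniq.
  by rewrite mem_undup; apply: sP.
have [|||p pP] := linear_of_graph (M := L) (N := M) (G := fun l m =>
  exists s, [/\ uniq s, forall x, x \notin s -> k l x = 0 &
    m = fin_supp_sum s (k l)]).
- by move=> l; have [s [us sP]] := supp_uniq l; exists (fin_supp_sum s (k l)), s.
- move=> l m m' [s [us sP ->]] [s' [us' sP' ->]].
  exact: fin_supp_sum_uniq.
- move=> a l m l' m' [s [us sP ->]] [s' [us' sP' ->]].
  pose t := undup (s ++ s'); have ut : uniq t by apply: undup_uniq.
  have tP x : x \notin t -> k l x = 0 /\ k l' x = 0.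
    by rewrite mem_undup mem_cat negb_or => /andP [/sP -> /sP' ->].
  exists t; split=> //.
    by move=> x /tP [lx l'x]; rewrite linearP /= !fctE lx l'x scaler0 addr0.
  rewrite (fin_supp_sum_uniq us ut) //; last by move=> x /tP [].
  rewrite (fin_supp_sum_uniq us' ut) //; last by move=> x /tP [].
  rewrite /fin_supp_sum scaler_sumr -big_split; apply: eq_bigr => x _ /=.
  by rewrite linearP /= !fctE scalerA -scalerDl.
exists L, p; split=> [m|ls].
  exists (e m); have [s [us sP ->]] := pP (e m).
  rewrite (@fin_supp_sum_uniq _ _ [:: m]) //.
    by rewrite /fin_supp_sum big_seq1 eP eqxx scale1r.
  by move=> x; rewrite inE eP => /negPf ->.
(* S supports all elements of [ls] at once; the basis elements at the points of S and their
   coordinate functionals form the dual system. *)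
have [S [uS SP]] : exists S, uniq S /\
    {in ls, forall l x, x \notin S -> k l x = 0}.
  elim: ls => [|l ls [S [uS SP]]]; first by exists [::].
  have [s [us sP]] := supp_uniq l; exists (undup (s ++ S)).
  split=> [|l']; first exact: undup_uniq.
  rewrite inE => /predU1P [->|l'ls] x; rewrite mem_undup mem_cat negb_or.
    by move=> /andP [/sP].
  by move=> /andP [_]; apply: SP.
exists [seq (e x, linear_of (coord_lin x)) | x <- S] => l lls.
apply: k_inj; apply/funext => y; rewrite /dual_expand big_map linear_sum.
rewrite fct_sumE (eq_bigr (fun x => (k l x : K) * (y == x)%:R)); last first.
  by move=> x _; rewrite linearZ /= eP.
have [yS|yS] := boolP (y \in S); last first.
  rewrite (SP l lls) // big1_seq // => x /andP [_ xS].
  by case: eqP yS => [->|_ _]; rewrite ?xS // mulr0.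
rewrite (bigD1_seq y) //= eqxx mulr1 big1 ?addr0 // => x /negPf.
by rewrite eq_sym => ->; rewrite mulr0.
Qed.

End FreeModule.

Lemma projective_locally_projective P : projective P -> locally_projective P.
Proof.
move=> P_proj; have [L [p [p_surj L_lp]]] := free_cover P.
have [s sK] := P_proj _ _ p idfun p_surj.
exact: locally_projective_retract (sK : cancel s p) L_lp.
Qed.

(** A dual system that reproduces the finitely many generators reproduces every element, by
    linearity. *)
Lemma finite_projective_dual_basis P :
  finitely_generated P -> projective P ->
  exists d : dual_system P, dual_basis d.
Proof.
move=> [n [e eP]] /projective_locally_projective /(_ (codom e)) [d dP].
exists d => x; have [a ->] := eP x.
rewrite /dual_expand (eq_bigr (fun p : P * {linear P -> K^o} =>
  \sum_k (a k * p.2 (e k) : K) *: p.1)).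
  rewrite exchange_big; apply: eq_bigr => k _ /=.
  rewrite -[in RHS](dP (e k)) ?codom_f // /dual_expand scaler_sumr.
  by apply: eq_bigr => p _; rewrite scalerA.
by move=> p _; rewrite linear_sum scaler_suml; apply: eq_bigr => k _;
  rewrite linearZ.
Qed.

End LocallyProjective.

(** * Contractions and flat modules *)

Section Flat.
Variable R : pzRingType.
Implicit Types A B D : lmodType R^c.
Implicit Types F G : lmodType R.

Fact contractl_balanced A F (u : {linear A -> R^c^o}) :
  balanced (fun (a : A) (x : F) => (u a : R) *: x).
Proof.
split=> [a b x|a x y|a r x]; rewrite ?scalerDr //.
  by rewrite linearD scalerDl.
by rewrite linearZ scalerA.
Qed.

(** This is u (x) F followed by the identification of R (x) F with F. *)
Definition contractl A F (u : {linear A -> R^c^o}) : tensor A F -> F :=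
  tensor_hom (contractl_balanced F u).

Arguments contractl {A} F u _.

HB.instance Definition _ A F (u : {linear A -> R^c^o}) :=
  GRing.Additive.on (contractl F u).

Lemma contractl_pure A F (u : {linear A -> R^c^o}) a (x : F) :
  contractl F u (pure_tensor a x) = (u a : R) *: x.
Proof. exact: tensor_hom_pure. Qed.

Lemma contractl_tmap A F G (u : {linear A -> R^c^o}) (f : {linear F -> G}) t :
  contractl G u (tmap idfun f t) = f (contractl F u t).
Proof.
apply: (@eq_tensor_hom _ _ _ _ (contractl G u \o tmap idfun f)
  (f \o contractl F u)) t => a x /=.
by rewrite tmap_pure !contractl_pure linearZ.
Qed.

Fact contractr_balanced A F (u : {linear F -> R^o}) :
  balanced (fun (a : A) (x : F) => (u x : R^c) *: a).
Proof.
split=> [a b x|a x y|a r x]; rewrite ?scalerDr //.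
  by rewrite linearD scalerDl.
by rewrite linearZ scalerA.
Qed.

Definition contractr A F (u : {linear F -> R^o}) : tensor A F -> A :=
  tensor_hom (contractr_balanced A u).

Arguments contractr A {F} u _.

HB.instance Definition _ A F (u : {linear F -> R^o}) :=
  GRing.Additive.on (contractr A u).

Lemma contractr_pure A F (u : {linear F -> R^o}) (a : A) x :
  contractr A u (pure_tensor a x) = (u x : R^c) *: a.
Proof. exact: tensor_hom_pure. Qed.

Lemma contractr_tmap A B F (u : {linear F -> R^o}) (f : {linear A -> B}) t :
  contractr B u (tmap f idfun t) = f (contractr A u t).
Proof.
apply: (@eq_tensor_hom _ _ _ _ (contractr B u \o tmap f idfun)
  (f \o contractr A u)) t => a x /=.
by rewrite tmap_pure !contractr_pure linearZ.
Qed.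

(** Expanding the left factors in the dual system and moving the coefficients across the tensor sign
    recovers t from its contractions. Only the finitely many left factors of one representative
    matter, so local projectivity suffices. *)
Lemma contractl_expand A F (d : dual_system A) (t : tensor A F) :
  {in [seq p.1 | p <- repr t], forall a, dual_expand d a = a} ->
  t = \sum_(p <- d) pure_tensor p.1 (contractl F p.2 t).
Proof.
move=> dP; rewrite {1}[t]tensor_sum.
transitivity (\sum_(q <- repr t) \sum_(p <- d)
    pure_tensor p.1 ((p.2 q.1 : R) *: q.2)).
  apply: eq_big_seq => q tq; rewrite -{1}(dP q.1) ?map_f //.
  by rewrite /dual_expand pure_tensor_suml; apply: eq_bigr => p _;
    rewrite pure_tensorM.
rewrite exchange_big; apply: eq_bigr => p _ /=.
rewrite {2}[t]tensor_sum raddf_sum pure_tensor_sumr.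
by apply: eq_bigr => q _; rewrite /= contractl_pure.
Qed.

Lemma contractr_expand A F (d : dual_system F) (t : tensor A F) :
  {in [seq p.2 | p <- repr t], forall x, dual_expand d x = x} ->
  t = \sum_(p <- d) pure_tensor (contractr A p.2 t) p.1.
Proof.
move=> dP; rewrite {1}[t]tensor_sum.
transitivity (\sum_(q <- repr t) \sum_(p <- d)
    pure_tensor ((p.2 q.2 : R^c) *: q.1) p.1).
  apply: eq_big_seq => q tq; rewrite -{1}(dP q.2) ?map_f //.
  by rewrite /dual_expand pure_tensor_sumr; apply: eq_bigr => p _;
    rewrite pure_tensorM.
rewrite exchange_big; apply: eq_bigr => p _ /=.
rewrite {2}[t]tensor_sum raddf_sum pure_tensor_suml.
by apply: eq_bigr => q _; rewrite /= contractr_pure.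
Qed.

(** Contractions commute with id (x) f, so if t is killed, then f kills each contraction of t. These
    vanish, and t with them. *)
Lemma locally_projective_tmap_injective A F G (f : {linear F -> G}) :
  locally_projective A -> injective f ->
  injective (tmap (idfun : {linear A -> A}) f).
Proof.
move=> A_lp f_inj; apply: raddf_inj => t ft0.
have [d dP] := A_lp [seq p.1 | p <- repr t].
rewrite (contractl_expand dP) big1 // => p _.
rewrite (_ : contractl _ _ _ = 0) ?pure_tensor0r //.
by apply: (injective_ker0 f_inj); rewrite -contractl_tmap ft0 raddf0.
Qed.

Lemma locally_projective_flat F : locally_projective F -> flat F.
Proof.
move=> F_lp A B i i_inj.
suff : injective (tmap i (idfun : {linear F -> F})) by [].
apply: raddf_inj => t it0; have [d dP] := F_lp [seq p.2 | p <- repr t].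
rewrite (contractr_expand dP) big1 // => p _.
rewrite (_ : contractr _ _ _ = 0) ?pure_tensor0l //.
by apply: (injective_ker0 i_inj); rewrite -contractr_tmap it0 raddf0.
Qed.

Lemma flat_tmap_injective A B F (i : {linear A -> B}) :
  flat F -> injective i -> injective (tmap i (idfun : {linear F -> F})).
Proof. by move=> F_flat; apply: F_flat. Qed.

Lemma isomorphic_flat F G : isomorphic F G -> flat F -> flat G.
Proof.
move=> [e e_bij] F_flat A B i i_inj.
have [e1 [eK e1K]] := linear_inverse (bij_inj e_bij) (bijective_surjective e_bij).
suff : injective (tmap i (idfun : {linear G -> G})) by [].
apply: raddf_inj => t it0.
have -> : t = tmap idfun e (tmap idfun e1 t).
  by rewrite (tmap_tmap (p2 := idfun) (q2 := idfun)) // tmap_id.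
rewrite (_ : tmap idfun e1 t = 0) ?raddf0 //.
apply: (flat_tmap_injective F_flat i_inj).
rewrite raddf0 (tmap_comm (p' := i) (p1' := idfun) (q' := idfun) (q1' := e1)) //.
by rewrite it0 raddf0.
Qed.

(* Tor_1(B, F'') = 0, by the snake lemma for a locally projective L -> B.     *)
Lemma flat_quotient_injective B (F' F F'' : lmodType R)
    (f : {linear F' -> F}) (g : {linear F -> F''}) :
  short_exact f g -> flat F'' -> injective (tmap (idfun : {linear B -> B}) f).
Proof.
move=> [f_inj fg g_surj] F''_flat; apply: raddf_inj => t ft0.
have [L [p [p_surj L_lp]]] := free_cover B.
have [K [k [k_inj kp]]] := kernel_inclusion p.
have id_surj (G : lmodType R) : surjective (idfun : {linear G -> G}).
  by move=> x; exists x.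
have [y yt] := tmap_surjective p_surj (id_surj F') t.
have [|z zy] := tmap_exact_l kp p_surj (t := tmap idfun f y).
  rewrite (tmap_comm (p' := p) (p1' := idfun) (q' := idfun) (q1' := f)) //.
  by rewrite yt ft0.
(* The image of z in L (x) F'' is zero, hence already in K (x) F'' since F'' is flat; so z comes
   from w in K (x) F'. *)
have [|w wz] := tmap_exact_r fg g_surj (t := z).
  apply: (flat_tmap_injective F''_flat k_inj).
  rewrite raddf0 (tmap_comm (p' := k) (p1' := idfun) (q' := idfun) (q1' := g)) //.
  rewrite zy (tmap_tmap (p2 := idfun) (q2 := g \o f)) // tmap_eq0 // => a x.
  by right; apply: exact_comp.
rewrite -yt (_ : y = tmap k idfun w).
  rewrite (tmap_tmap (p2 := p \o k) (q2 := idfun)) // tmap_eq0 // => a x.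
  by left; apply: exact_comp.
apply: (locally_projective_tmap_injective L_lp f_inj); rewrite -zy -wz.
exact: tmap_comm.
Qed.

(** A kernel element in A (x) F dies in A (x) F'', so it comes from A (x) F'; there it vanishes
    because B (x) F' -> B (x) F is injective by [flat_quotient_injective]. *)
Lemma flat_extension (F' F F'' : lmodType R) (f : {linear F' -> F})
    (g : {linear F -> F''}) :
  short_exact f g -> flat F' -> flat F'' -> flat F.
Proof.
move=> ex F'_flat F''_flat A B i i_inj; have [f_inj fg g_surj] := ex.
suff : injective (tmap i (idfun : {linear F -> F})) by [].
apply: raddf_inj => t it0.
have [|u ut] := tmap_exact_r fg g_surj (t := t).
  apply: (flat_tmap_injective F''_flat i_inj).
  rewrite raddf0 (tmap_comm (p' := i) (p1' := idfun) (q' := idfun) (q1' := g)) //.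
  by rewrite it0 raddf0.
rewrite -ut (_ : u = 0) ?raddf0 //; apply: (flat_tmap_injective F'_flat i_inj).
apply: (flat_quotient_injective ex F''_flat).
rewrite !raddf0 (tmap_comm (p' := idfun) (p1' := i) (q' := f) (q1' := idfun)) //.
by rewrite ut.
Qed.

(** Split g into a surjection and the inclusion of its image: right exactness handles the former,
    flatness the latter. *)
Lemma flat_exact A B D F (f : {linear A -> B}) (g : {linear B -> D}) :
  flat F -> exact_at f g ->
  forall t, tmap g (idfun : {linear F -> F}) t = 0 ->
  exists u, tmap f (idfun : {linear F -> F}) u = t.
Proof.
move=> F_flat fg t gt0;
  have [I [p [i [p_surj i_inj ip]]]] := image_factorization g.
have fp : exact_at f p.
  by move=> x; rewrite -(fg x) -ip; split=> [->|/(injective_ker0 i_inj)];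
    rewrite ?linear0.
apply: (tmap_exact_l fp p_surj); apply: (flat_tmap_injective F_flat i_inj).
by rewrite raddf0 (tmap_tmap (p2 := g) (q2 := idfun)).
Qed.

End Flat.

(** * Hom modules and the adjunction between C (x)_R - and Hom_S(C, -) *)

Section HomModules.
Variables (S R : pzRingType) (C : bimodType S R).

Section HomZmodule.
Variables (K : pzRingType) (U V : lmodType K).

Definition hom : Type := {linear U -> V}.

Definition hom_app (h : hom) : {linear U -> V} := h.

HB.instance Definition _ := gen_eqMixin hom.
HB.instance Definition _ := gen_choiceMixin hom.

Definition hom_zero : hom := (\0 : U -> V) : {linear U -> V}.
Definition hom_add (f g : hom) : hom :=
  (hom_app f \+ hom_app g) : {linear U -> V}.
Definition hom_opp (f : hom) : hom := (\- hom_app f) : {linear U -> V}.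

Fact hom_addA : associative hom_add.
Proof. by move=> f g h; apply: linear_ext => x /=; rewrite addrA. Qed.

Fact hom_addC : commutative hom_add.
Proof. by move=> f g; apply: linear_ext => x /=; rewrite addrC. Qed.

Fact hom_add0 : left_id hom_zero hom_add.
Proof. by move=> f; apply: linear_ext => x /=; rewrite add0r. Qed.

Fact hom_addN : left_inverse hom_zero hom_opp hom_add.
Proof. by move=> f; apply: linear_ext => x /=; rewrite addNr. Qed.

HB.instance Definition _ := GRing.isZmodule.Build hom
  hom_addA hom_addC hom_add0 hom_addN.

End HomZmodule.

(* Hom_S(P, C) with the right R-action (h r)(x) = h(x) r. *)
Definition rhom (P : lmodType S) : Type := hom P C.

HB.instance Definition _ P := GRing.Zmodule.on (rhom P).

Definition rhom_app P (h : rhom P) : {linear P -> C} := h.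

Definition rhom_scale P (r : R^c) (h : rhom P) : rhom P :=
  (rhomothety C r \o rhom_app h) : {linear P -> C}.

Fact rhom_scaleA P r r' (h : rhom P) :
  rhom_scale r (rhom_scale r' h) = rhom_scale (r * r') h.
Proof. by apply: linear_ext => x; rewrite /= /rhomothety_fun -ractA. Qed.

Fact rhom_scale1 P : left_id 1 (@rhom_scale P).
Proof. by move=> h; apply: linear_ext => x; apply: ract1. Qed.

Fact rhom_scaleDr P : right_distributive (@rhom_scale P) +%R.
Proof. by move=> r h h'; apply: linear_ext => x; apply: ractDl. Qed.

Fact rhom_scaleDl P h : {morph (@rhom_scale P)^~ h : r r' / r + r'}.
Proof. by move=> r r'; apply: linear_ext => x; apply: ractDr. Qed.

HB.instance Definition _ P := GRing.Zmodule_isLmodule.Build R^c (rhom P)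
  (@rhom_scaleA P) (@rhom_scale1 P) (@rhom_scaleDr P) (@rhom_scaleDl P).

Definition rhom_pre (P Q : lmodType S) (d : {linear P -> Q})
    (h : rhom Q) : rhom P :=
  (rhom_app h \o d) : {linear P -> C}.

Fact rhom_pre_linear (P Q : lmodType S) (d : {linear P -> Q}) :
  linear (rhom_pre d).
Proof. by move=> r h h'; apply: linear_ext. Qed.

HB.instance Definition _ (P Q : lmodType S) (d : {linear P -> Q}) :=
  GRing.isLinear.Build R^c (rhom Q) (rhom P) *:%R (rhom_pre d)
    (rhom_pre_linear d).

(* Hom_(R^op)(Q, C) with the left S-action (s h)(x) = s h(x). *)
Definition lhom (Q : lmodType R^c) : Type := hom Q (rmod C).

HB.instance Definition _ Q := GRing.Zmodule.on (lhom Q).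

Definition lhom_app Q (h : lhom Q) : {linear Q -> rmod C} := h.

Definition lhom_scale Q (s : S) (h : lhom Q) : lhom Q :=
  (lhomothety C s \o lhom_app h) : {linear Q -> rmod C}.

Fact lhom_scaleA Q s s' (h : lhom Q) :
  lhom_scale s (lhom_scale s' h) = lhom_scale (s * s') h.
Proof. by apply: linear_ext => x; apply: (scalerA s s' (_ : C)). Qed.

Fact lhom_scale1 Q : left_id 1 (@lhom_scale Q).
Proof. by move=> h; apply: linear_ext => x; apply: (scale1r (_ : C)). Qed.

Fact lhom_scaleDr Q : right_distributive (@lhom_scale Q) +%R.
Proof. by move=> s h h'; apply: linear_ext => x; apply: (scalerDr s (_ : C)). Qed.

Fact lhom_scaleDl Q h : {morph (@lhom_scale Q)^~ h : s s' / s + s'}.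
Proof. by move=> s s'; apply: linear_ext => x; apply: (scalerDl (_ : C)). Qed.

HB.instance Definition _ Q := GRing.Zmodule_isLmodule.Build S (lhom Q)
  (@lhom_scaleA Q) (@lhom_scale1 Q) (@lhom_scaleDr Q) (@lhom_scaleDl Q).

Definition lhom_pre (P Q : lmodType R^c) (d : {linear P -> Q})
    (h : lhom Q) : lhom P :=
  (lhom_app h \o d) : {linear P -> rmod C}.

Fact lhom_pre_linear (P Q : lmodType R^c) (d : {linear P -> Q}) :
  linear (lhom_pre d).
Proof. by move=> r h h'; apply: linear_ext. Qed.

HB.instance Definition _ (P Q : lmodType R^c) (d : {linear P -> Q}) :=
  GRing.isLinear.Build S (lhom Q) (lhom P) *:%R (lhom_pre d)
    (lhom_pre_linear d).

Definition bhom_app I (h : bhom C I) : {linear C -> I} := h.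

Lemma bhom_ext I (h h' : bhom C I) :
  (forall c, bhom_app h c = bhom_app h' c) -> h = h'.
Proof. exact: linear_ext. Qed.

Definition bhom_post (I J : lmodType S) (f : {linear I -> J})
    (h : bhom C I) : bhom C J :=
  (f \o bhom_app h) : {linear C -> J}.

Fact bhom_post_linear (I J : lmodType S) (f : {linear I -> J}) :
  linear (bhom_post f).
Proof.
move=> r h h'; apply: linear_ext => c; rewrite /bhom_post /=.
exact: (linearD f (bhom_app h (ract c r)) (bhom_app h' c)).
Qed.

HB.instance Definition _ (I J : lmodType S) (f : {linear I -> J}) :=
  GRing.isLinear.Build R (bhom C I) (bhom C J) *:%R (bhom_post f)
    (bhom_post_linear f).

Lemma btensor_ind F (P : btensor C F -> Prop) : P 0 ->
  (forall c x t, P t -> P (bpure c x + t)) -> forall t, P t.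
Proof. exact: (@tensor_ind_pure _ _ _ P). Qed.

Lemma eq_btensor F (Z : zmodType) (f g : {additive btensor C F -> Z}) :
  (forall c x, f (bpure c x) = g (bpure c x)) -> f =1 g.
Proof.
move=> fg; elim/btensor_ind=> [|c x t IHt]; first by rewrite !raddf0.
by rewrite !raddfD /= fg IHt.
Qed.

Lemma scale_bpure (F : lmodType R) (s : S) (c : C) (x : F) :
  s *: bpure c x = bpure (s *: c) x.
Proof. exact: btensor_scale_pure. Qed.

Lemma btensor_scalable F (W : lmodType S) (f : {additive btensor C F -> W}) :
  (forall s c x, f (bpure (s *: c) x) = s *: f (bpure c x)) -> scalable f.
Proof.
move=> fZ s t.
elim/btensor_ind: t => [|c x t IHt]; first by rewrite !raddf0.
by rewrite !raddfD /= IHt scale_bpure fZ.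
Qed.

Section BTensorMap.
Variables (F G : lmodType R) (q : {linear F -> G}).

Definition btensor_map : btensor C F -> btensor C G :=
  tmap (idfun : {linear rmod C -> rmod C}) q.

HB.instance Definition _ := GRing.Additive.on btensor_map.

Fact btensor_map_scalable : scalable btensor_map.
Proof.
have mapE c x : btensor_map (bpure c x) = bpure c (q x) by apply: tmap_pure.
by apply: btensor_scalable => s c x; rewrite /= !mapE scale_bpure.
Qed.

HB.instance Definition _ := GRing.isScalable.Build S (btensor C F) (btensor C G)
  *:%R btensor_map btensor_map_scalable.

End BTensorMap.

Section Evaluation.
Variable W : lmodType S.

Fact evaluation_balanced :
  balanced (fun (c : rmod C) (h : bhom C W) => bhom_app h (c : C)).
Proof. by split=> // c c' h; apply: (linearD (bhom_app h)). Qed.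

(** The counit of the adjunction. *)
Definition evaluation : btensor C (bhom C W) -> W :=
  tensor_hom evaluation_balanced.

HB.instance Definition _ := GRing.Additive.on evaluation.

Fact evaluation_scalable : scalable evaluation.
Proof.
have evE c h : evaluation (bpure c h) = bhom_app h c.
  exact: (tensor_hom_pure evaluation_balanced).
by apply: btensor_scalable => s c h; rewrite /= !evE linearZ.
Qed.

HB.instance Definition _ := GRing.isScalable.Build S (btensor C (bhom C W)) W
  *:%R evaluation evaluation_scalable.

Lemma evaluation_pure c h : evaluation (bpure c h) = bhom_app h c.
Proof. exact: (tensor_hom_pure evaluation_balanced). Qed.

End Evaluation.

Lemma btensor_map_pure (F G : lmodType R) (q : {linear F -> G}) c x :
  btensor_map q (bpure c x) = bpure c (q x).
Proof. exact: tmap_pure. Qed.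

Lemma evaluation_natural (W W' : lmodType S) (f : {linear W -> W'}) t :
  @evaluation W' (btensor_map (bhom_post f) t) = f (@evaluation W t).
Proof.
apply: (@eq_btensor _ _ (@evaluation W' \o btensor_map (bhom_post f))
  (f \o @evaluation W)) t => c h /=.
by rewrite btensor_map_pure !evaluation_pure.
Qed.

Section Unit.
Variable F : lmodType R.

Fact bpure_linear (x : F) : linear (fun c => bpure c x : btensor C F).
Proof.
by move=> s c c'; rewrite scale_bpure; apply: (@pure_tensorDl _ (rmod C)).
Qed.

(** The unit of the adjunction. *)
Definition unit_map (x : F) : bhom C (btensor C F) := linear_of (bpure_linear x).

Fact unit_linear : linear unit_map.
Proof.
move=> r x y; apply: linear_ext => c /=.
rewrite /bpure pure_tensorDr -pure_tensorM; congr (_ + _).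
Qed.

HB.instance Definition _ := GRing.isLinear.Build R F (bhom C (btensor C F)) *:%R
  unit_map unit_linear.

End Unit.

End HomModules.

(** * Comparing Hom_S(P, C) (x) F with Hom_S(P, C (x) F) *)

Section HomTensor.
Variables (S R : pzRingType) (C : bimodType S R).
Variables (P : lmodType S) (F : lmodType R).

Fact hom_tensor_balanced (x : P) :
  balanced (fun (h : rhom C P) (y : F) => bpure (rhom_app h x) y).
Proof.
split=> [h h' y|h y y'|h r y].
- exact: (@pure_tensorDl _ (rmod C)).
- exact: pure_tensorDr.
- exact: (@pure_tensorM _ (rmod C)).
Qed.

(* The natural map Hom_S(P, C) (x) F -> Hom_S(P, C (x) F), evaluated at x.    *)
Definition hom_tensor (x : P) : tensor (rhom C P) F -> btensor C F :=
  tensor_hom (hom_tensor_balanced x).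

HB.instance Definition _ x := GRing.Additive.on (hom_tensor x).

Lemma hom_tensor_pure x h y :
  hom_tensor x (pure_tensor h y) = bpure (rhom_app h x) y.
Proof. exact: (tensor_hom_pure (hom_tensor_balanced x)). Qed.

Lemma hom_tensor_linear t : linear (hom_tensor^~ t).
Proof.
move=> s x x'; elim/tensor_ind_pure: t => [|h y t IHt] /=.
  by rewrite !raddf0 addr0.
rewrite !raddfD /= IHt addrACA !hom_tensor_pure scale_bpure.
congr (_ + _); rewrite linearP.
exact: (@pure_tensorDl _ (rmod C)).
Qed.

Fact rank_one_linear (u : {linear P -> S^o}) (c : rmod C) :
  linear (fun x => (u x : S) *: (c : C)).
Proof. by move=> s x y; rewrite linearP scalerDl scalerA. Qed.

Definition rank_one (u : {linear P -> S^o}) (c : rmod C) : rhom C P :=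
  linear_of (rank_one_linear u c).

Fact rank_one_balanced (u : {linear P -> S^o}) :
  balanced (fun (c : rmod C) (y : F) => pure_tensor (rank_one u c) y).
Proof.
split=> [c c' y|c y y'|c r y].
- rewrite -pure_tensorDl; congr pure_tensor; apply: linear_ext => x /=.
  exact: (scalerDr (u x : S) (c : C) (c' : C)).
- exact: pure_tensorDr.
- rewrite -pure_tensorM; congr pure_tensor; apply: linear_ext => x /=.
  by apply/esym; apply: ractZ.
Qed.

Definition rank_one_tensor (u : {linear P -> S^o}) :
  btensor C F -> tensor (rhom C P) F := tensor_hom (rank_one_balanced u).

HB.instance Definition _ u := GRing.Additive.on (rank_one_tensor u).

Lemma rank_one_tensor_pure u c y :
  rank_one_tensor u (bpure c y) = pure_tensor (rank_one u c) y.
Proof. exact: (tensor_hom_pure (rank_one_balanced u)). Qed.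

Lemma hom_tensor_rank_one x (u : {linear P -> S^o}) t :
  hom_tensor x (rank_one_tensor u t) = (u x : S) *: t.
Proof.
elim/btensor_ind: t => [|c y t IHt]; first by rewrite !raddf0.
by rewrite !raddfD /= IHt rank_one_tensor_pure hom_tensor_pure scale_bpure.
Qed.

(** For a dual basis (e_i, u_i), any h : P -> C is the sum of the rank one maps x |-> u_i(x) h(e_i).
    Hence sending f to the sum of the [rank_one_tensor u_i (f e_i)] inverts the natural map; the two
    lemmas after [hom_tensor_rank_one] and this one draw the conclusion. *)
Lemma rank_one_hom_tensor (d : dual_system P) t :
  dual_basis d -> \sum_(p <- d) rank_one_tensor p.2 (hom_tensor p.1 t) = t.
Proof.
move=> dP; elim/tensor_ind_pure: t => [|h y t IHt].
  by rewrite big1 // => p _; rewrite !raddf0.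
rewrite (eq_bigr (fun p : P * {linear P -> S^o} =>
  rank_one_tensor p.2 (hom_tensor p.1 (pure_tensor h y)) +
  rank_one_tensor p.2 (hom_tensor p.1 t))); last first.
  by move=> p _; rewrite !raddfD.
rewrite big_split /= IHt; congr (_ + _).
under eq_bigr do rewrite hom_tensor_pure rank_one_tensor_pure.
rewrite -pure_tensor_suml; congr pure_tensor; apply: linear_ext => x.
rewrite -[in RHS](dP x) /dual_expand linear_sum /=.
rewrite (@big_morph _ _ (fun h : rhom C P => rhom_app h x) 0 +%R) //.
by apply: eq_bigr => p _ /=; rewrite linearZ.
Qed.

Lemma hom_tensor_injective (d : dual_system P) t :
  dual_basis d -> (forall x, hom_tensor x t = 0) -> t = 0.
Proof.
move=> dP t0; rewrite -(rank_one_hom_tensor t dP) big1 // => p _.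
by rewrite t0 raddf0.
Qed.

Lemma hom_tensor_surjective (d : dual_system P) (f : {linear P -> btensor C F}) :
  dual_basis d -> exists t, forall x, hom_tensor x t = f x.
Proof.
move=> dP; exists (\sum_(p <- d) rank_one_tensor p.2 (f p.1)) => x.
rewrite raddf_sum -[in RHS](dP x) /dual_expand linear_sum.
by apply: eq_bigr => p _; rewrite /= hom_tensor_rank_one linearZ.
Qed.

End HomTensor.

Lemma hom_tensor_pre (S R : pzRingType) (C : bimodType S R) (P Q : lmodType S)
    (F : lmodType R) (d : {linear P -> Q}) x (t : tensor (rhom C Q) F) :
  hom_tensor x (tmap (rhom_pre d) idfun t) = hom_tensor (d x) t.
Proof.
elim/tensor_ind_pure: t => [|h y t IHt]; first by rewrite !raddf0.
by rewrite !raddfD /= IHt tmap_pure !hom_tensor_pure.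
Qed.

(** * Comparing Q (x) Hom_S(C, I) with Hom_S(Hom(Q, C), I) *)

Section TensorHom.
Variables (S R : pzRingType) (C : bimodType S R).
Variables (Q : lmodType R^c) (I : lmodType S).

Fact tensor_bhom_balanced (l : lhom C Q) :
  balanced (fun (q : Q) (h : bhom C I) => bhom_app h (lhom_app l q : C)).
Proof.
split=> [q q' h|q h h'|q r h] //.
  rewrite [lhom_app l _]linearD.
  exact: (linearD (bhom_app h) (lhom_app l q : C) (lhom_app l q' : C)).
by rewrite [lhom_app l _]linearZ.
Qed.

(* The natural map Q (x) Hom_S(C, I) -> Hom_S(Hom_(R^op)(Q, C), I), evaluated *)
(* at l.                                                                      *)
Definition tensor_bhom (l : lhom C Q) : tensor Q (bhom C I) -> I :=
  tensor_hom (tensor_bhom_balanced l).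

HB.instance Definition _ l := GRing.Additive.on (tensor_bhom l).

Lemma tensor_bhom_pure l q h :
  tensor_bhom l (pure_tensor q h) = bhom_app h (lhom_app l q : C).
Proof. exact: (tensor_hom_pure (tensor_bhom_balanced l)). Qed.

Lemma tensor_bhom_linear t : linear (tensor_bhom^~ t).
Proof.
move=> s l l'; elim/tensor_ind_pure: t => [|q h t IHt] /=.
  by rewrite !raddf0 addr0.
rewrite !raddfD /= IHt addrACA !tensor_bhom_pure; congr (_ + _).
exact: (linearP (bhom_app h) s (lhom_app l q : C) (lhom_app l' q : C)).
Qed.

Fact lrank_one_linear (u : {linear Q -> R^c^o}) (c : C) :
  linear (fun q => (u q : R^c) *: (c : rmod C)).
Proof. by move=> r x y; rewrite linearP scalerDl scalerA. Qed.

Definition lrank_one (u : {linear Q -> R^c^o}) (c : C) : lhom C Q :=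
  linear_of (lrank_one_linear u c).

Lemma lrank_one_is_linear u : linear (lrank_one u).
Proof.
move=> s c c'; apply: linear_ext => q /=.
rewrite [LHS](scalerDr (u q : R^c) (s *: c : rmod C) (c' : rmod C)).
by congr (_ + _); apply: ractZ.
Qed.

Lemma contractl_bhom (u : {linear Q -> R^c^o}) (t : tensor Q (bhom C I)) c :
  bhom_app (contractl u t) c = tensor_bhom (lrank_one u c) t.
Proof.
elim/tensor_ind_pure: t => [|q h t IHt]; first by rewrite !raddf0.
rewrite !raddfD /= -IHt tensor_bhom_pure.
by rewrite -[contractl u (pure_tensor _ _)]/(contractl _ _) contractl_pure.
Qed.

(** By [contractl_bhom] the contractions of t are its values at rank one maps, and they determine
    t. *)
Lemma tensor_bhom_injective (d : dual_system Q) t :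
  dual_basis d -> (forall l, tensor_bhom l t = 0) -> t = 0.
Proof.
move=> dP t0; rewrite (@contractl_expand _ _ _ d t); last by move=> q _;
  apply: dP.
rewrite big1 // => p _; rewrite (_ : contractl _ _ = 0) ?pure_tensor0r //.
by apply: linear_ext => c; rewrite [LHS]contractl_bhom t0.
Qed.

Lemma tensor_bhom_surjective (d : dual_system Q) (f : {linear lhom C Q -> I}) :
  dual_basis d -> exists t, forall l, tensor_bhom l t = f l.
Proof.
move=> dP.
pose h u : bhom C I := f \o linear_of (lrank_one_is_linear u).
exists (\sum_(p <- d) pure_tensor p.1 (h p.2)) => l.
have lE : l = \sum_(p <- d) lrank_one p.2 (lhom_app l p.1 : C).
  apply: linear_ext => q; rewrite -[in LHS](dP q) /dual_expand linear_sum /=.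
  rewrite (@big_morph _ _ (fun h : lhom C Q => lhom_app h q) 0 +%R) //.
  by apply: eq_bigr => p _ /=; rewrite linearZ.
rewrite [in RHS]lE linear_sum raddf_sum; apply: eq_bigr => p _ /=.
by rewrite tensor_bhom_pure.
Qed.

End TensorHom.

Lemma tensor_bhom_pre (S R : pzRingType) (C : bimodType S R)
    (P Q : lmodType R^c) (I : lmodType S) (d : {linear P -> Q}) l
    (t : tensor P (bhom C I)) :
  tensor_bhom l (tmap d idfun t) = tensor_bhom (lhom_pre d l) t.
Proof.
elim/tensor_ind_pure: t => [|q h t IHt]; first by rewrite !raddf0.
by rewrite !raddfD /= IHt tmap_pure !tensor_bhom_pure.
Qed.

Lemma finite_resolution_dual_basis (K : pzRingType) (M : lmodType K)
    (P : resolution M) n :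
  (forall n, finitely_generated (P n)) ->
  exists d : dual_system (P n), dual_basis d.
Proof.
by move=> P_fg; apply: finite_projective_dual_basis; last exact: res_projective.
Qed.

Lemma short_exact_isol (K : pzRingType) (L M' M M'' : lmodType K)
    (e : {linear L -> M'}) (f : {linear M' -> M}) (g : {linear M -> M''}) :
  bijective e -> short_exact f g -> short_exact (f \o e) g.
Proof.
move=> e_bij [f_inj fg g_surj]; split=> //.
  exact: inj_comp (bij_inj e_bij).
move=> x; rewrite (fg x); split=> [[y <-]|[y <-]]; last by exists (e y).
by have [z <-] := bijective_surjective e_bij y; exists z.
Qed.

Lemma short_exact_isor (K : pzRingType) (L M' M M'' : lmodType K)
    (f : {linear M' -> M}) (g : {linear M -> M''}) (e : {linear M'' -> L}) :
  bijective e -> short_exact f g -> short_exact f (e \o g).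
Proof.
move=> e_bij [f_inj fg g_surj]; split=> //.
  move=> x; rewrite -(fg x) /=;
    split=> [/(injective_ker0 (bij_inj e_bij))|->] //.
  exact: linear0.
move=> y; have [z <-] := bijective_surjective e_bij y.
by have [x <-] := g_surj z; exists x.
Qed.

(** * The semidualizing conditions and the unit at flat modules *)

Section FoxbyClasses.
Variables (S R : pzRingType) (C : bimodType S R).
Hypothesis C_sd : semidualizing C.

Section Augmentation.
Variable P : resolution (C : lmodType S).

(** The map Hom_S(C, C) -> Hom_S(P_0, C) induced by the augmentation, with R in place of Hom_S(C, C)
    as (b2) permits. *)
Definition rhom_aug (r : R^c^o) : rhom C (P 0%N) :=
  (rhomothety C (r : R) \o res_aug P) : {linear P 0%N -> C}.

Fact rhom_aug_linear : linear rhom_aug.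
Proof.
by move=> a r r'; apply: linear_ext => x;
  rewrite /= /rhomothety_fun ractDr ractA.
Qed.

HB.instance Definition _ := GRing.isLinear.Build R^c R^c^o (rhom C (P 0%N)) *:%R
  rhom_aug rhom_aug_linear.

Lemma rhom_aug_injective : injective rhom_aug.
Proof.
move=> r r' e; apply: (bij_inj (sd_b2 C_sd)); apply: linear_ext => c.
have [x <-] := res_aug_surj P c.
exact: (congr1 (fun h : rhom C (P 0%N) => rhom_app h x) e).
Qed.

(** A map P_0 -> C that kills boundaries descends to an endomorphism of C, which is a homothety by
    (b2). *)
Lemma rhom_aug_exact : exact_at rhom_aug (rhom_pre (res_diff P 0%N)).
Proof.
move=> h; split=> [hd0|[r <-]].
  have [|h1 h1P] := factor_through_surjection (f := rhom_app h) (@res_aug_surj _ _ P).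
    move=> x /(@res_aug_exact _ _ P _).1 [y <-].
    exact: (congr1 (fun k : rhom C (P 1%N) => rhom_app k y) hd0).
  have [r rP] := bijective_surjective (sd_b2 C_sd) h1.
  by exists r; apply: linear_ext => x; rewrite -[RHS]h1P -rP.
apply: linear_ext => x /=.
by rewrite (exact_comp x (@res_aug_exact _ _ P)) linear0.
Qed.

Lemma rhom_pre_exact :
  exact_at (rhom_pre (C := C) (res_diff P 0%N)) (rhom_pre (res_diff P 1%N)).
Proof.
move=> h; split=> [hd0|[g <-]].
  have [|g gP] := @sd_c1 _ _ _ C_sd 1%N isT P (rhom_app h).
    by move=> x; apply: (congr1 (fun k : rhom C (P 2%N) => rhom_app k x) hd0).
  by exists g; apply: linear_ext => x; rewrite /= gP.
by apply: linear_ext => x /=;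
  rewrite (exact_comp x (@res_exact _ _ P 0%N)) linear0.
Qed.

End Augmentation.

Section FlatModule.
Variables (F : lmodType R) (F_flat : flat F).

(** Tensoring [rhom_aug] with the flat F gives an injection of F = R (x) F into Hom_S(P_0, C) (x) F.
    Read through [hom_tensor], it is the unit composed with the augmentation. *)
Lemma unit_map_injective : injective (unit_map C (F := F)).
Proof.
apply: raddf_inj => y y0; have [P P_fg] := sd_a1 C_sd.
have [d dP] := finite_resolution_dual_basis 0%N P_fg.
have t0 : pure_tensor (1 : R^c^o) y = 0.
  apply: (flat_tmap_injective F_flat (@rhom_aug_injective P)); rewrite raddf0.
  apply: (hom_tensor_injective dP) => x; rewrite tmap_pure hom_tensor_pure /=.
  rewrite /rhomothety_fun ract1.
  exact: (congr1 (fun h : bhom C (btensor C F) => bhom_app h (res_aug P x)) y0).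
have := congr1 (contractl (idfun : {linear R^c^o -> R^c^o})) t0.
by rewrite contractl_pure raddf0 scale1r.
Qed.

Lemma unit_map_surjective : surjective (unit_map C (F := F)).
Proof.
move=> f; have [P P_fg] := sd_a1 C_sd.
have [d0 d0P] := finite_resolution_dual_basis 0%N P_fg.
have [d1 d1P] := finite_resolution_dual_basis 1%N P_fg.
(* The map f composed with the augmentation is a 0-cocycle, so its tensor t comes from R (x) F by
   exactness. *)
have [t tP] := hom_tensor_surjective (bhom_app f \o res_aug P) d0P.
have [|u ut] := flat_exact F_flat (@rhom_aug_exact P) (t := t).
  apply: (hom_tensor_injective d1P) => x; rewrite hom_tensor_pre tP /=.
  by rewrite (exact_comp x (@res_aug_exact _ _ P)) linear0.
exists (contractl (idfun : {linear R^c^o -> R^c^o}) u); apply: bhom_ext => c.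
have [x <-] := res_aug_surj P c; rewrite -[RHS]tP -ut.
(* With the dual basis (1, id) of R, the tensor u becomes 1 (x) y for the witness y. *)
rewrite (@contractl_expand _ _ _ [:: (1 : R^c^o, idfun : {linear R^c^o -> R^c^o})] u).
  rewrite !big_seq1 tmap_pure hom_tensor_pure contractl_pure /= /rhomothety_fun.
  by rewrite ract1 scale1r.
by move=> a _; rewrite /dual_expand big_seq1 /=; apply: mulr1.
Qed.

Lemma btensor_coboundary (P : resolution (C : lmodType S))
    (f : {linear P 1%N -> btensor C F}) :
  (forall n, finitely_generated (P n)) -> (forall x, f (res_diff P 1%N x) = 0) ->
  exists g : {linear P 0%N -> btensor C F}, forall x, f x = g (res_diff P 0%N x).
Proof.
move=> P_fg fd0.
have [d1 d1P] := finite_resolution_dual_basis 1%N P_fg.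
have [d2 d2P] := finite_resolution_dual_basis 2%N P_fg.
have [t tP] := hom_tensor_surjective f d1P.
have [|u ut] := flat_exact F_flat (@rhom_pre_exact P) (t := t).
  by apply: (hom_tensor_injective d2P) => x; rewrite hom_tensor_pre tP.
exists (linear_of (hom_tensor_linear u)) => x /=.
by rewrite -hom_tensor_pre ut tP.
Qed.

(* Ext^1_S(C, C (x) F) = 0, in the form of the lifting property it yields.    *)
Lemma bhom_lift (W W'' : lmodType S) (f : {linear btensor C F -> W})
    (g : {linear W -> W''}) :
  short_exact f g -> surjective (bhom_post (C := C) g).
Proof.
move=> [f_inj fg g_surj] u; have [P P_fg] := sd_a1 C_sd.
have [v vP] := @res_projective _ _ P 0%N _ _ g (bhom_app u \o res_aug P) g_surj.
(* The lift v of u on P_0 fails to descend to C by the 1-cocycle w with values in C (x) F. Writing w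
   as the coboundary of z, the corrected lift v - f z descends. *)
have [|w wP] := factor_through_injection (f := v \o res_diff P 0%N) f_inj.
  move=> x; apply: (fg _).1; rewrite /= vP /=.
  by rewrite (exact_comp x (@res_aug_exact _ _ P)) linear0.
have [|z zP] := btensor_coboundary (f := w) P_fg.
  move=> x; apply: f_inj; rewrite wP /= linear0.
  by rewrite (exact_comp x (@res_exact _ _ P 0%N)) linear0.
have [|h hP] := factor_through_surjection (f := (v \- (f \o z)) : {linear P 0%N -> W})
    (@res_aug_surj _ _ P).
  by move=> x /(@res_aug_exact _ _ P _).1 [y <-] /=; rewrite -zP wP /= subrr.
exists h; apply: bhom_ext => c; have [x <-] := res_aug_surj P c.
by rewrite /= hP linearB vP /= (exact_comp _ fg) subr0.
Qed.

End FlatModule.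

(** The map i is the adjoint of e, namely the unit followed by Hom_S(C, e). The formula for i is
    what [FC_evaluation] uses. *)
Lemma btensor_bhom_isomorphism F (W : lmodType S) (e : {linear btensor C F -> W}) :
  flat F -> bijective e ->
  exists2 i : {linear F -> bhom C W}, bijective i &
    forall c x, bhom_app (i x) c = e (bpure c x).
Proof.
move=> F_flat e_bij.
have [e1 [_ e1K]] := linear_inverse (bij_inj e_bij) (bijective_surjective e_bij).
exists (bhom_post e \o unit_map C (F := F)) => //.
have [||j [iK jK]] := linear_inverse (f := bhom_post e \o unit_map C (F := F)).
- move=> x y /= exy; apply: (unit_map_injective F_flat); apply: bhom_ext => c.
  apply: (bij_inj e_bij).
  exact: (congr1 (fun h : bhom C W => bhom_app h c) exy).
- move=> h; have [y yP] := unit_map_surjective F_flat (bhom_post e1 h).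
  exists y; apply: bhom_ext => c; rewrite -[RHS]e1K.
  exact: (congr1 (fun k : bhom C (btensor C F) => e (bhom_app k c)) yP).
by exists j.
Qed.

Lemma PC_FC (W : lmodType S) : PC C W -> FC C W.
Proof.
move=> [P [P_proj PW]]; exists P; split=> //.
exact/locally_projective_flat/projective_locally_projective.
Qed.

Lemma FC_bhom_flat (W : lmodType S) : FC C W -> flat (bhom C W).
Proof.
move=> [F [F_flat [e e_bij]]].
have [i i_bij _] := btensor_bhom_isomorphism F_flat e_bij.
by apply: isomorphic_flat F_flat; exists i.
Qed.

Lemma PC_bhom_projective (W : lmodType S) : PC C W -> projective (bhom C W).
Proof.
move=> [P [P_proj [e e_bij]]].
have P_flat := locally_projective_flat (projective_locally_projective P_proj).
have [i i_bij _] := btensor_bhom_isomorphism P_flat e_bij.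
by apply: isomorphic_projective P_proj; exists i.
Qed.

(** A triangle identity: the counit composed with C (x) i is e, and both i and e are bijective. *)
Lemma FC_evaluation (W : lmodType S) : FC C W ->
  injective (evaluation (C := C) (W := W)) /\
  surjective (evaluation (C := C) (W := W)).
Proof.
move=> [F [F_flat [e e_bij]]].
have [i i_bij iE] := btensor_bhom_isomorphism F_flat e_bij.
have [j [iK jK]] := linear_inverse (bij_inj i_bij) (bijective_surjective i_bij).
have evi t : evaluation (btensor_map i t) = e t.
  apply: (eq_btensor (f := evaluation (C := C) (W := W) \o btensor_map i)) => c x /=.
  by rewrite btensor_map_pure evaluation_pure iE.
split=> [|w]; last first.
  by have [t <-] := bijective_surjective e_bij w; exists (btensor_map i t).
apply: raddf_inj => t evt0; have ij : btensor_map i (btensor_map j t) = t.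
  apply: (eq_btensor (f := btensor_map i \o btensor_map j) (g := idfun)) => c x /=.
  by rewrite !btensor_map_pure jK.
rewrite -ij (_ : btensor_map j t = 0) ?raddf0 //.
by apply: (injective_ker0 (bij_inj e_bij)); rewrite -evi ij.
Qed.

(** * Extensions with ends in F_C or P_C *)

Section Extension.
Variables (W' W W'' : lmodType S) (f : {linear W' -> W}) (g : {linear W -> W''}).
Hypothesis fg_exact : short_exact f g.

Lemma FC_bhom_exact : FC C W' ->
  short_exact (bhom_post (C := C) f) (bhom_post (C := C) g).
Proof.
move=> [F [F_flat [e e_bij]]]; have [f_inj fg g_surj] := fg_exact.
split; last exact: (bhom_lift F_flat (short_exact_isol e_bij fg_exact)).
- move=> h h' e'; apply: bhom_ext => c; apply: f_inj.
  exact: (congr1 (fun k : bhom C W => bhom_app k c) e').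
move=> h; split=> [gh0|[k <-]]; last first.
  by apply: bhom_ext => c; rewrite /= (exact_comp _ fg).
have [|k kP] := factor_through_injection (f := bhom_app h) f_inj.
  move=> c; apply: (fg _).1.
  exact: (congr1 (fun k : bhom C W'' => bhom_app k c) gh0).
by exists k; apply: bhom_ext.
Qed.

(** The five lemma for the counit, between C (x) Hom_S(C, X) and X. Right exactness of the upper row
    suffices, since f is injective. *)
Lemma FC_extension_evaluation : FC C W' -> FC C W'' ->
  isomorphic (btensor C (bhom C W)) W.
Proof.
move=> FW' FW''; have [f_inj fg g_surj] := fg_exact.
have [_ pfg pg_surj] := FC_bhom_exact FW'.
have [[ev'_inj ev'_surj] [ev''_inj ev''_surj]] := (FC_evaluation FW', FC_evaluation FW'').
apply: (isomorphicP (f := evaluation (C := C) (W := W))) => [|w].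
  apply: raddf_inj => t evt0.
  have [|u ut] := tmap_exact_r (A := rmod C) pfg pg_surj (t := t).
    apply: (injective_ker0 ev''_inj (x := btensor_map (bhom_post g) t)).
    by rewrite /= evaluation_natural evt0 linear0.
  rewrite -ut -[tmap _ _ u]/(btensor_map (bhom_post f) (u : btensor C _)).
  rewrite (_ : u = 0) ?raddf0 //; apply: (injective_ker0 ev'_inj).
  apply: (injective_ker0 f_inj); rewrite /= -evaluation_natural.
  by rewrite -[btensor_map _ _]/(tmap idfun (bhom_post f) u) ut.
have [s sP] := ev''_surj (g w).
have id_surj : surjective (idfun : {linear rmod C -> rmod C}) by move=> c;
  exists c.
have [t ts] := tmap_surjective id_surj pg_surj s.
have [|w' w'P] := (fg (w - evaluation (t : btensor C _))).1.
  rewrite linearB /= -evaluation_natural.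
  by rewrite -[btensor_map _ _]/(tmap idfun (bhom_post g) t) ts sP subrr.
have [u uP] := ev'_surj w';
  exists ((t : btensor C _) + btensor_map (bhom_post f) u).
by rewrite linearD /= evaluation_natural uP w'P addrC subrK.
Qed.

Lemma FC_extension : FC C W' -> FC C W'' -> FC C W.
Proof.
move=> FW' FW''; exists (bhom C W); split; last exact: FC_extension_evaluation.
exact: flat_extension (FC_bhom_exact FW') (FC_bhom_flat FW') (FC_bhom_flat FW'').
Qed.

Lemma PC_extension : PC C W' -> PC C W'' -> splits f g /\ PC C W.
Proof.
move=> PW' PW''; have [FW' FW''] := (PC_FC PW', PC_FC PW'').
have pfg := FC_bhom_exact FW'; have [_ _ pg_surj] := pfg.
split; last first.
  exists (bhom C W); split; last exact: FC_extension_evaluation.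
  exact: projective_extension pfg (PC_bhom_projective PW') (PC_bhom_projective PW'').
have [s sK] := PC_bhom_projective PW'' idfun pg_surj.
have [ev_inj ev_surj] := FC_evaluation FW''.
have [v [_ vK]] := linear_inverse ev_inj ev_surj.
(* The section s of Hom_S(C, g) is tensored with C and carried back to X by the counits; naturality
   shows that it is a section of g. *)
apply: (section_splits (s := evaluation (C := C) (W := W) \o (btensor_map s \o v))) => //.
move=> w /=; rewrite -evaluation_natural -[RHS]vK; congr (evaluation _).
apply: (eq_btensor (f := btensor_map (bhom_post g) \o btensor_map s) (g := idfun)) => c x /=.
by rewrite !btensor_map_pure sK.
Qed.

End Extension.

(** * Splitting and extensions in I_C *)

Section Injective.
Variable I : lmodType S.
Hypothesis I_inj : injective_module I.

(* Tor_1^R(C, Hom_S(C, I)) = 0, read off a finite resolution Q of C_R.        *)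
Lemma tensor_bhom_exact (Q : resolution (rmod C : lmodType R^c))
    (t : tensor (Q 1%N) (bhom C I)) :
  (forall n, finitely_generated (Q n)) ->
  tmap (res_diff Q 0%N) idfun t = 0 ->
  exists u, tmap (res_diff Q 1%N) idfun u = t.
Proof.
move=> Q_fg dt0.
have [d1 d1P] := finite_resolution_dual_basis 1%N Q_fg.
have [d2 d2P] := finite_resolution_dual_basis 2%N Q_fg.
(* Seen as a map Hom(Q_1, C) -> I, t kills the kernel of Hom(Q_1, C) -> Hom(Q_2, C): by (c2) this
   kernel comes from Hom(Q_0, C), where t acts through its zero boundary. So the map extends to
   Hom(Q_2, C), and the extension is represented by u. *)
have [|f fP] := injective_module_extend (f := lhom_pre (C := C) (res_diff Q 1%N))
    (g := linear_of (tensor_bhom_linear t)) I_inj.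
  move=> l ld0 /=.
  have [|l0 l0P] := @sd_c2 _ _ _ C_sd 1%N isT Q (lhom_app l).
    by move=> x; apply: (congr1 (fun k : lhom C (Q 2%N) => lhom_app k x) ld0).
  have -> : l = lhom_pre (res_diff Q 0%N) l0 by apply: linear_ext.
  by rewrite -tensor_bhom_pre dt0 raddf0.
have [u uP] := tensor_bhom_surjective f d2P; exists u.
apply/eqP; rewrite -subr_eq0; apply/eqP;
  apply: (tensor_bhom_injective d1P) => l.
by rewrite raddfB /= tensor_bhom_pre uP fP subrr.
Qed.

(** The long exact Tor sequence at Tor_1(C, Hom_S(C, I)) = 0, as a diagram chase in Q tensored with
    the given sequence. *)
Lemma btensor_map_injective (U' U : lmodType R) (h : {linear U' -> U})
    (k : {linear U -> bhom C I}) :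
  short_exact h k -> injective (btensor_map (C := C) h).
Proof.
move=> [h_inj hk k_surj]; have [Q Q_fg] := sd_a2 C_sd.
have [d0 d0P] := finite_resolution_dual_basis 0%N Q_fg.
have Q0_lp := locally_projective_dual_basis d0P.
have id_surj (A : lmodType R) : surjective (idfun : {linear A -> A}).
  by move=> x; exists x.
have idQ_surj n : surjective (idfun : {linear Q n -> Q n}) by move=> x;
  exists x.
have [eps_surj eps_exact] := (@res_aug_surj _ _ Q, @res_aug_exact _ _ Q).
suff : injective (tmap (idfun : {linear rmod C -> rmod C}) h) by [].
apply: raddf_inj => x hx0.
have [y yx] := tmap_surjective eps_surj (id_surj U') x.
have [|z zP] := tmap_exact_l eps_exact eps_surj (t := tmap idfun h y).
  rewrite (tmap_comm (p' := res_aug Q) (p1' := idfun) (q' := idfun) (q1' := h)) //.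
  by rewrite yx hx0.
have [|u uP] := tensor_bhom_exact (t := tmap idfun k z) Q_fg.
  rewrite (tmap_comm (p' := res_diff Q 0%N) (p1' := idfun) (q' := idfun) (q1' := k)) //.
  rewrite zP (tmap_tmap (p2 := idfun) (q2 := k \o h)) // tmap_eq0 // => a b.
  by right; apply: exact_comp.
(* Subtracting the boundary of w from z leaves its boundary unchanged and makes it vanish in Q_1 (x)
   Hom_S(C, I), so it comes from v in Q_1 (x) U'. *)
have [w wP] := tmap_surjective (idQ_surj 2%N) k_surj u.
have [|v vP] := tmap_exact_r hk k_surj (t := z - tmap (res_diff Q 1%N) idfun w).
  rewrite raddfB /= -uP -wP.
  by rewrite (tmap_comm (p' := idfun) (p1' := res_diff Q 1%N) (q' := k) (q1' := idfun))
    ?subrr.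
rewrite -yx (_ : y = tmap (res_diff Q 0%N) idfun v).
  rewrite (tmap_tmap (p2 := res_aug Q \o res_diff Q 0%N) (q2 := idfun)) //.
  by rewrite tmap_eq0 // => a b; left; apply: exact_comp.
have dd0 : tmap (res_diff Q 0%N) idfun (tmap (res_diff Q 1%N) idfun w) = 0.
  rewrite (tmap_tmap (p2 := res_diff Q 0%N \o res_diff Q 1%N) (q2 := idfun)) //.
  by rewrite tmap_eq0 // => a b; left; apply: exact_comp (@res_exact _ _ Q 0%N).
apply: (locally_projective_tmap_injective Q0_lp h_inj).
rewrite (tmap_comm (p' := idfun) (p1' := res_diff Q 0%N) (q' := h) (q1' := idfun)) //.
by rewrite vP raddfB /= zP dd0 subr0.
Qed.

End Injective.

Lemma IC_splits (U' U U'' : lmodType R) (h : {linear U' -> U})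
    (k : {linear U -> U''}) :
  short_exact h k -> IC C U' -> IC C U'' -> splits h k.
Proof.
move=> hk_exact [I' [I'_inj [e' e'_bij]]] [I'' [I''_inj [e'' e''_bij]]].
have [x' [e'K x'K]] := linear_inverse (bij_inj e'_bij) (bijective_surjective e'_bij).
have [x'' [e''K x''K]] :=
  linear_inverse (bij_inj e''_bij) (bijective_surjective e''_bij).
have x''_bij : bijective x'' by exists e''.
have h_inj := btensor_map_injective I''_inj (short_exact_isor x''_bij hk_exact).
(* The map extended is the adjoint C (x) U' -> I' of the isomorphism U' = Hom_S(C, I'); the adjoint
   of its extension b is the retraction. *)
have [b bP] := I'_inj _ _ (btensor_map h)
  (evaluation (C := C) (W := I') \o btensor_map x') h_inj.
apply: (retraction_splits (r := e' \o (bhom_post b \o unit_map C (F := U)))) => // u.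
rewrite /= -[RHS]x'K; congr (e' _); apply: bhom_ext => c /=.
have := bP (bpure c u); rewrite /= !btensor_map_pure evaluation_pure.
by [].
Qed.

(** Hom_S(C, -) preserves products, and a product of two injectives is injective. *)
Lemma IC_split_extension (U' U U'' : lmodType R) (h : {linear U' -> U})
    (k : {linear U -> U''}) :
  short_exact h k -> splits h k -> IC C U' -> IC C U'' -> IC C U.
Proof.
move=> [_ hk _] [r [s [hK sK hrsk]]].
move=> [I' [I'_inj [e' e'_bij]]] [I'' [I''_inj [e'' e''_bij]]].
exists (I' * I'')%type; split; first exact: injective_module_prod.
have kh x : k (h x) = 0 by apply: exact_comp.
(* This follows from the decomposition identity of [splits] at s x, as k s = id and h is
   injective. *)
have rs x : r (s x) = 0.
  by apply: (can_inj hK); apply: (addIr (s (k (s x))));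
    rewrite hrsk linear0 add0r sK.
pose p1 : {linear bhom C (I' * I'')%type -> bhom C I'} :=
  bhom_post (fst : {linear (I' * I'')%type -> I'}).
pose p2 : {linear bhom C (I' * I'')%type -> bhom C I''} :=
  bhom_post (snd : {linear (I' * I'')%type -> I''}).
have phi_lin : linear (fun a => h (e' (p1 a)) + s (e'' (p2 a))).
  by move=> c a a'; rewrite !linearP /= scalerDr addrACA.
apply: (isomorphicP (f := linear_of phi_lin)) => [|u].
  apply: raddf_inj => a /= a0.
  have r0 := congr1 r a0; have k0 := congr1 k a0.
  move: r0 k0; rewrite !linearD /= hK rs addr0 kh sK add0r !linear0.
  move=> /(injective_ker0 (bij_inj e'_bij)) a1 /(injective_ker0 (bij_inj e''_bij)) a2.
  apply: bhom_ext => c; apply/eqP; rewrite -pair_eqE /=; apply/andP; split;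
    apply/eqP.
    exact: (congr1 (fun b : bhom C I' => bhom_app b c) a1).
  exact: (congr1 (fun b : bhom C I'' => bhom_app b c) a2).
have [a' a'P] := bijective_surjective e'_bij (r u).
have [a'' a''P] := bijective_surjective e''_bij (k u).
have a_lin : linear (fun c => (bhom_app a' c, bhom_app a'' c)).
  by move=> c x y; rewrite !linearP.
exists (linear_of a_lin : bhom C _) => /=.
have -> : p1 (linear_of a_lin) = a' by apply: bhom_ext.
have -> : p2 (linear_of a_lin) = a'' by apply: bhom_ext.
by rewrite a'P a''P hrsk.
Qed.

End FoxbyClasses.

Theorem proposition5p6 (R S : pzRingType) (C : bimodType S R)
    (semidualizing_C : semidualizing C)
    (W' W W'' : lmodType S) (f : {linear W' -> W}) (g : {linear W -> W''})
    (exact_X : short_exact f g)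
    (U' U U'' : lmodType R) (h : {linear U' -> U}) (k : {linear U -> U''})
    (exact_Y : short_exact h k) :
  [/\ FC C W' -> FC C W'' -> FC C W,
      PC C W' -> PC C W'' -> splits f g /\ PC C W &
      IC C U' -> IC C U'' -> splits h k /\ IC C U].
Proof.
split=> [FW' FW''|PW' PW''|IU' IU''].
- exact: FC_extension exact_X FW' FW''.
- exact: PC_extension exact_X PW' PW''.
have hk_splits := IC_splits semidualizing_C exact_Y IU' IU''.
by split=> //; apply: IC_split_extension exact_Y hk_splits IU' IU''.
Qed.
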